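(* For $k,i\in\mathbb{N}$ let $Y_{\omega+k}^{(i)}=\{(x_1,\ldots,x_i)\in(2^k\mathbb{Z})^i : |\{j : x_j\notin 2^i\mathbb{Z}\}|\leq k\}$, let $Y_{\omega+k}=\mathrm{as}\bigsqcup_{i=1}^{\infty}Y_{\omega+k}^{(i)}$, and let $Y_{2\omega}=\mathrm{as}\bigsqcup_{k=1}^{\infty}Y_{\omega+k}$. Then $\operatorname{coasdim}(Y_{2\omega})=2\omega$ and $\operatorname{trasdim}(Y_{2\omega})=2\omega$.
   Context: $\mathbb{N}=\{1,2,3,\ldots\}$; $\omega$ is the smallest infinite ordinal and $2\omega$ denotes the ordinal $\omega+\omega$. Families of subsets. Let $(X,d)$ be a metric space. For $r>0$, a family $\mathcal{U}$ of subsets of $X$ is $r$-disjoint if $d(U,V)=\inf\{d(x,y):x\in U,y\in V\}>r$ for all $U\neq V$ in $\mathcal{U}$. It is uniformly bounded if $\sup\{\operatorname{diam}U:U\in\mathcal{U}\}<\infty$. $\bigcup\mathcal{U}$ denotes the union of the members of $\mathcal{U}$. Transfinite asymptotic dimension. Let $Fin\,\mathbb{N}$ be the collection of all finite nonempty subsets of $\mathbb{N}$. For $M\subseteq Fin\,\mathbb{N}$ and $\sigma\in\{\varnothing\}\cup Fin\,\mathbb{N}$ let $M^{\sigma}=\{\tau\in Fin\,\mathbb{N}:\tau\cup\sigma\in M,\ \tau\cap\sigma=\varnothing\}$, and $M^a=M^{\{a\}}$ for $a\in\mathbb{N}$. Define $\operatorname{Ord}M$ inductively: $\operatorname{Ord}M=0$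 iff $M=\varnothing$; $\operatorname{Ord}M\leq\alpha$ (for an ordinal $\alpha>0$) iff $\operatorname{Ord}M^a<\alpha$ for every $a\in\mathbb{N}$; $\operatorname{Ord}M=\alpha$ iff $\operatorname{Ord}M\leq\alpha$ and $\operatorname{Ord}M<\alpha$ is not true; $\operatorname{Ord}M=\infty$ iff $\operatorname{Ord}M\leq\alpha$ holds for no ordinal $\alpha$. For a metric space $X$, let $A(X)$ be the set of $\sigma\in Fin\,\mathbb{N}$ for which there are no uniformly bounded families $\mathcal{U}_i$ ($i\in\sigma$) of subsets of $X$ such that each $\mathcal{U}_i$ is $i$-disjoint and $\bigcup_{i\in\sigma}\mathcal{U}_i$ covers $X$. Then $\operatorname{trasdim}(X)=\operatorname{Ord}A(X)$. Complementary-finite asymptotic dimension. Every ordinal $\gamma$ is written $\gamma=\lambda(\gamma)+n(\gamma)$ with $\lambda(\gamma)$ a limit ordinal or $0$ and $n(\gamma)\in\mathbb{N}\cup\{0\}$. Define $\operatorname{coasdim}$ inductively: $\operatorname{coasdim}(X)=-1$ iff $X=\emptyset$; $\operatorname{coasdim}(X)\leq\gamma$ iff for every $r>0$ there exist $r$-disjoint uniformly bounded families $\mathcal{U}_0,\ldots,\mathcal{U}_{n(\gamma)}$ of subsets of $X$ such that $\operatorname{coasdim}(X\setminus\bigcup(\bigcup_{i=0}^{n(\gamma)}\mathcal{U}_i))<\lambda(\gamma)$; $\operatorname{coasdim}(X)=\gamma$ iff $\operatorname{coasdim}(X)\leq\gamma$ and $\operatorname{coasdim}(X)\leq\beta$ is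 not true for every $\beta<\gamma$; $\operatorname{coasdim}(X)=\infty$ iff $\operatorname{coasdim}(X)\leq\gamma$ holds for no ordinal $\gamma$. Asymptotic union. For a sequence $\{Z_i\}_{i=1}^\infty$ of subspaces of a metric space $(Z,d_Z)$, the asymptotic union $\mathrm{as}\bigsqcup_{i=1}^{\infty}Z_i$ is the disjoint union of the $Z_i$ with the metric given, for $x$ in the $l$-th summand $Z_l$ and $y$ in the $k$-th summand $Z_k$ with $l\leq k$, by $d(x,y)=d_Z(x,y)+c$, where $c=0$ if $l=k$ and $c=l+(l+1)+\cdots+(k-1)$ if $l<k$. Ambient spaces. $\mathbb{R}^j$ is regarded as a subspace of $(\bigoplus\mathbb{R},d_{\max})$, the space of finitely supported real sequences with the max metric ($\mathbb{R}^j$ being the sequences vanishing after the $j$-th coordinate). Each $Y_{\omega+k}$ is a subspace of the metric space $\mathrm{as}\bigsqcup_{j=1}^{\infty}\mathbb{R}^j$ (with $Y_{\omega+k}^{(i)}\subset\mathbb{R}^i$), and $Y_{2\omega}$ is the asymptotic union of the sequence $\{Y_{\omega+k}\}_{k\ge1}$ of subspaces of $Z=\mathrm{as}\bigsqcup_{j=1}^{\infty}\mathbb{R}^j$. *)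

(* Defs.v *)
From HB Require Import structures.
From mathcomp Require Import all_boot all_order all_algebra finmap.
From mathcomp Require Import all_classical all_reals all_analysis.

Set Implicit Arguments.
Unset Strict Implicit.
Unset Printing Implicit Defensive.

Import Order.TTheory GRing.Theory Num.Theory.

Local Open Scope classical_set_scope.
Local Open Scope ring_scope.
Local Open Scope card_scope.

(* The convention N = {1, 2, 3, ...}. *)
Record posnat : Type := Posnat { nat_of_posnat :> nat; _ : (0 < nat_of_posnat)%N }.

HB.instance Definition _ := [isSub for nat_of_posnat].
HB.instance Definition _ := [Countable of posnat by <:].

(* Ordinals as well-founded trees: [osup f] is the least ordinal strictly above
   every [f i]. Equality of ordinals is [oeq], not Leibniz equality. *)
Inductive ordnum : Type := osup (T : Type) (f : T -> ordnum).

Fixpoint ole (a b : ordnum) {struct a} : Prop :=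
  match a, b with osup T f, osup U g => forall i, exists j, ole (f i) (g j) end.

Definition olt (a b : ordnum) : Prop :=
  match b with osup U g => exists j, ole a (g j) end.

Definition oeq (a b : ordnum) : Prop := ole a b /\ ole b a.

Definition ozero : ordnum := osup (fun e : Empty_set => match e with end).

Definition osucc (a : ordnum) : ordnum := osup (fun _ : unit => a).

Definition onat (n : nat) : ordnum := iter n osucc ozero.

Definition omega : ordnum := osup onat.

(* The elements of a + b are those of a, followed by the a + c for c < b. *)
Fixpoint oadd (a b : ordnum) {struct b} : ordnum :=
  match a, b with osup T f, osup U g =>
    osup (fun k : T + U => match k with inl i => f i | inr j => oadd a (g j) end)
  end.

Definition olimit (a : ordnum) : Prop :=
  olt ozero a /\ forall b, olt b a -> olt (osucc b) a.

(* l = lambda(c) and n = n(c). *)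
Definition odecomp (c l : ordnum) (n : nat) : Prop :=
  oeq c (oadd l (onat n)) /\ (oeq l ozero \/ olimit l).

Section Families.
Context {R : realType} {X : metricType R}.
Implicit Types (A U V : set X) (F : set (set X)).

Local Open Scope ereal_scope.

(* The infimum and the supremum are taken in the extended reals, so that the
   distance to the empty set is +oo; the diameter of the empty set is -oo,
   which does not affect [uniformly_bounded]. *)
Definition set_dist U V : \bar R :=
  ereal_inf [set (mdist p.1 p.2)%:E | p in U `*` V].

Definition diam U : \bar R :=
  ereal_sup [set (mdist p.1 p.2)%:E | p in U `*` U].

Definition r_disjoint (r : R) F : Prop :=
  forall U V, F U -> F V -> U <> V -> r%:E < set_dist U V.

Definition uniformly_bounded F : Prop := ereal_sup [set diam U | U in F] < +oo.

Definition family_of_subsets A F : Prop := forall U, F U -> U `<=` A.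

Definition family_union F : set X := \bigcup_(U in F) U.

End Families.

Section TransfiniteOrd.

(* An element of Fin N is a nonempty [{fset posnat}]. *)
Definition fin_trace (M : set {fset posnat}) (s : {fset posnat}) : set {fset posnat} :=
  [set t | t <> fset0 /\ M (t `|` s)%fset /\ (t `&` s)%fset = fset0].

(* [Ord_le M a] is "Ord M <= a" and [Ord_lt M a] is "Ord M < a". *)
Inductive Ord_le : set {fset posnat} -> ordnum -> Prop :=
| Ord_le_zero a : oeq a ozero -> Ord_le set0 a
| Ord_le_pos M a : olt ozero a ->
    (forall n : posnat, Ord_lt (fin_trace M [fset n]%fset) a) -> Ord_le M a
with Ord_lt : set {fset posnat} -> ordnum -> Prop :=
| Ord_lt_le M a b : olt b a -> Ord_le M b -> Ord_lt M a.

Definition Ord_eq (M : set {fset posnat}) (a : ordnum) : Prop :=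
  Ord_le M a /\ ~ Ord_lt M a.

End TransfiniteOrd.

(* A subset A of a metric space is regarded as a metric space with the
   restricted distance. *)
Section Dimensions.
Context {R : realType} {X : metricType R}.
Implicit Types A : set X.

Definition trasdim_family A : set {fset posnat} :=
  [set s | s <> fset0 /\
    ~ exists F : posnat -> set (set X),
        (forall i, i \in s ->
           [/\ family_of_subsets A (F i), uniformly_bounded (F i)
             & r_disjoint i%:R (F i)])
        /\ A `<=` \bigcup_(i in [set` s]) family_union (F i)].

Definition trasdim_eq A (c : ordnum) : Prop := Ord_eq (trasdim_family A) c.

(* [coasdim_lt A a] is "coasdim A < a"; its first constructor accounts for the
   value -1 of the empty space, and is the only way to be below 0. *)
Inductive coasdim_le : set X -> ordnum -> Prop :=
| CoasdimLe A c l n : odecomp c l n ->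
    (forall r : R, 0 < r -> exists F : 'I_n.+1 -> set (set X),
       (forall i, [/\ family_of_subsets A (F i), uniformly_bounded (F i)
                    & r_disjoint r (F i)])
       /\ coasdim_lt (A `\` \bigcup_i family_union (F i)) l) ->
    coasdim_le A c
with coasdim_lt : set X -> ordnum -> Prop :=
| CoasdimLtEmpty a : coasdim_lt set0 a
| CoasdimLtLe A a b : olt b a -> coasdim_le A b -> coasdim_lt A a.

Definition coasdim_eq A (c : ordnum) : Prop :=
  coasdim_le A c /\ ~ coasdim_lt A c.

End Dimensions.

Section AsymptoticUnion.

(* l + (l + 1) + ... + (k - 1) for l <= k, symmetrically for k <= l. *)
Definition as_gap (l k : nat) : nat := \sum_(minn l k <= j < maxn l k) j.

Lemma as_gapxx l : as_gap l l = 0%N.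
Proof. by rewrite /as_gap minnn maxnn big_geq. Qed.

Lemma as_gapC l k : as_gap l k = as_gap k l.
Proof. by rewrite /as_gap minnC maxnC. Qed.

Lemma as_gap_eq0 (l k : posnat) : as_gap l k = 0%N -> l = k.
Proof.
wlog lk : l k / (l <= k)%N => [hw|].
  have [/hw//|/ltnW/hw h] := leqP l k.
  by rewrite as_gapC => /h.
rewrite /as_gap (minn_idPl lk) (maxn_idPr lk) => /eqP s0.
apply/val_inj/eqP; rewrite eqn_leq lk /= leqNgt; apply/negP => ltlk.
move: s0; rewrite big_ltn // addn_eq0 => /andP[l0 _].
by have := valP l; rewrite /= (eqP l0).
Qed.

Lemma as_gap_triangle m l k : (as_gap l k <= as_gap l m + as_gap m k)%N.
Proof.
wlog lk : l k / (l <= k)%N => [hw|].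
  have [/hw//|/ltnW/hw h] := leqP l k.
  by rewrite (as_gapC l k) addnC (as_gapC m k) (as_gapC l m).
rewrite /as_gap (minn_idPl lk) (maxn_idPr lk).
have [lm|ml] := leqP l m; have [mk|km] := leqP m k.
- by rewrite -big_cat_nat.
- by rewrite (big_cat_nat lk (ltnW km)) /= -addnA leq_addr.
- by rewrite (big_cat_nat (ltnW ml) lk) /= addnA leq_addl.
- by have := leq_trans km (leq_trans (ltnW ml) lk); rewrite ltnn.
Qed.

(* The asymptotic union of the constant sequence X; the asymptotic union of a
   sequence of subspaces Z_i of X is its subspace [as_union Z]. *)
Definition as_copies (X : Type) : Type := (posnat * X)%type.

HB.instance Definition _ (X : choiceType) := Choice.on (as_copies X).

Context {R : realType}.

Section Distance.
Context {X : metricType R}.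

Definition as_dist (p q : as_copies X) : R :=
  mdist p.2 q.2 + (as_gap p.1 q.1)%:R.

Let as_distxx p : as_dist p p = 0.
Proof. by rewrite /as_dist mdistxx as_gapxx addr0. Qed.

Let as_dist_positivity p q : as_dist p q = 0 -> p = q.
Proof.
move=> /eqP; rewrite /as_dist paddr_eq0 ?mdist_ge0 ?ler0n// pnatr_eq0.
case: p q => [l x] [k y] /= /andP[/eqP/mdist_positivity-> /eqP/as_gap_eq0->].
by [].
Qed.

Let as_dist_sym p q : as_dist p q = as_dist q p.
Proof. by rewrite /as_dist metric_sym as_gapC. Qed.

Let as_dist_triangle q p s : as_dist p s <= as_dist p q + as_dist q s.
Proof.
rewrite /as_dist addrACA lerD ?metric_triangle// -natrD ler_nat.
exact: as_gap_triangle.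
Qed.

HB.instance Definition _ := @isMetric.Build R (as_copies X) as_dist as_distxx
  as_dist_positivity as_dist_sym as_dist_triangle.

End Distance.

Definition as_union {X : metricType R} (Z : posnat -> set X) :
    set (as_copies X) :=
  [set p | Z p.1 p.2].

End AsymptoticUnion.

Section DirectSum.
Variable R : realType.

Definition direct_sum : Type := {fsfun posnat -> R with 0}.

HB.instance Definition _ := Choice.on direct_sum.

Implicit Types x y z : direct_sum.

(* The maximum of |x_j - y_j| over all coordinates j. *)
Definition max_dist x y : R :=
  \big[Num.max/0]_(j <- (finsupp x `|` finsupp y)%fset) `|x j - y j|.

Lemma max_dist_ge x y j : `|x j - y j| <= max_dist x y.
Proof.
rewrite /max_dist; have [jxy|] := boolP (j \in (finsupp x `|` finsupp y)%fset).
  rewrite -[_ \in _]/(j \in enum_fset _) in jxy.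
  elim: (enum_fset _) jxy => //= i s IHs.
  rewrite inE big_cons le_max => /orP[/eqP->|/IHs->]; last by rewrite orbT.
  by rewrite lexx.
rewrite in_fsetU negb_or => /andP[jx jy].
rewrite !fsfun_dflt // subrr normr0.
exact: bigmax_ge_id.
Qed.

Lemma max_dist_le x y (e : R) :
  0 <= e -> (forall j, `|x j - y j| <= e) -> max_dist x y <= e.
Proof. by move=> e0 xye; exact: bigmax_le. Qed.

Let max_distxx x : max_dist x x = 0.
Proof.
apply/eqP; rewrite eq_le max_dist_le//=; last by move=> j; rewrite subrr normr0.
by apply: le_trans (max_dist_ge x x (@Posnat 1 isT)); rewrite subrr normr0.
Qed.

Let max_dist_positivity x y : max_dist x y = 0 -> x = y.
Proof.
move=> xy0; apply/fsfunP => j; apply/eqP.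
by rewrite -subr_eq0 -normr_le0 (le_trans (max_dist_ge x y j))// xy0.
Qed.

Let max_dist_sym x y : max_dist x y = max_dist y x.
Proof. by rewrite /max_dist fsetUC; apply: eq_bigr => j _; rewrite distrC. Qed.

Let max_dist_triangle y x z : max_dist x z <= max_dist x y + max_dist y z.
Proof.
have ge0 u v : 0 <= max_dist u v.
  exact: le_trans (max_dist_ge u v (@Posnat 1 isT)).
apply: max_dist_le => [|j]; first exact: addr_ge0.
by rewrite (le_trans (ler_distD (y j) _ _))// lerD// max_dist_ge.
Qed.

HB.instance Definition _ := @isMetric.Build R direct_sum max_dist max_distxx
  max_dist_positivity max_dist_sym max_dist_triangle.

Definition euclid (n : posnat) : set direct_sum :=
  [set x | forall j : posnat, (n < j)%N -> x j = 0].

Definition pow2Z (k : nat) : set R := range (fun m : int => 2 ^+ k * m%:~R).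

Definition Y_piece (k i : posnat) : set direct_sum :=
  [set x | [/\ euclid i x,
               forall j : posnat, (j <= i)%N -> pow2Z k (x j)
             & [set j : posnat | (j <= i)%N /\ ~ pow2Z i (x j)] #<= `I_k]].

Definition Y_omega_plus (k : posnat) : set (as_copies direct_sum) :=
  as_union (Y_piece k).

Definition Y_2omega : set (as_copies (as_copies direct_sum)) :=
  as_union Y_omega_plus.

End DirectSum.

Arguments Y_piece : clear implicits.
Arguments Y_omega_plus : clear implicits.
Arguments Y_2omega : clear implicits.

(* Main.v *)
From mathcomp Require Import all_boot all_order all_algebra finmap.
From mathcomp Require Import all_classical all_reals all_analysis.
From mathcomp Require Import zify ring lra.
Require Import Defs.

(** Write a point of [Y_2omega] as (k, (i, x)), where x is a vector of the
    piece i of the k-th space. Its coordinates lie in 2^k Z, and at most k of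
    them lie outside 2^i Z: x is on the k-skeleton of the cubulation of R^i by
    cubes of side 2^i.

    Upper bounds. At a given scale r, the points with k >= k0 are handled by a
    single r-disjoint bounded family, because their vectors are 2^k-separated
    and different k or i are far apart; only the copies of a vector in the
    first few pieces of one space have to be put together ([cover_large]).
    For k < k0 a trick of Kolmogorov gives k0 + 1 families ([colour_cover]).
    The line is given k0 + 1 colours; a colour is a periodic family of
    intervals whose gaps avoid the multiples of the period and the gaps of
    the other colours. A coordinate in 2^i Z misses no colour and any other
    coordinate misses at most one, so one of the k0 + 1 colours is missed by
    no coordinate of x, and x lies in a box of that colour. The size of the
    boxes does not depend on i, as soon as 2^i is a multiple of the period
    ([cover_skeleta]). What is left has k and i bounded, and the same trick
    covers it at any scale by a fixed number of families ([cover_finite]).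
    Thus the remainders have coasdim at most omega + k0, then a finite one.
    For trasdim the families are charged to the elements of a finite set: one
    to a given element, k0 + 1 to further ones, the last ones to the rest.

    Lower bounds. If coasdim or trasdim of [Y_2omega] were below 2 omega, then
    for some n, for every r there would be an m such that, for every r', the
    space is covered by n + 1 families at scale r and m + 1 families at scale
    r', all bounded ([split_cover]). For trasdim the bounds of all the
    families may depend on r', so that they may be much larger than any cube.
    Take k = n + 1 and i = n + m + 2. A full grid of dimension i is mapped to
    the cubulated space by collapsing the walls of a thickened cubulation
    ([collapse]). Grid points with at most n + 1 coordinates outside the walls
    land in the skeleton and inherit the colour of their image. The other ones
    have at most m coordinates in the walls, so the trick of Kolmogorov, with
    gaps cut in the walls, puts them in bounded boxes of m + 1 colours. These
    are identified with the m + 1 coarse colours: as r' is much larger than a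
    box, a box touches at most one member of its coarse family, and is merged
    with it. The grid of dimension i is then covered by i families of
    separated bounded sets ([two_scale_contradiction]), which contradicts the
    Lebesgue covering theorem ([lebesgue_grid]). The latter follows from a
    discrete Poincare-Miranda theorem ([cubical_miranda]), proved by computing
    a cup product of 1-cocycles modulo 2. *)

Set Implicit Arguments.
Unset Strict Implicit.
Unset Printing Implicit Defensive.

Import Order.TTheory GRing.Theory Num.Theory.
Local Open Scope classical_set_scope.
Local Open Scope ring_scope.
Local Open Scope card_scope.

(** * The Lebesgue covering theorem for grids *)

Section Miranda.
Variable (I : finType).
Implicit Types (v u : I -> nat) (A B : {set I}) (l : seq I).
(* Cochains take values in the field with two elements, which is [bool]. *)

Definition shift v a : I -> nat := fun j => (v j + (j == a))%N.
Definition upd v a t : I -> nat := fun j => if j == a then t else v j.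

Variable chi : I -> (I -> nat) -> bool.

(** The cup product of the coboundaries of the functions [chi b], for b in l,
    evaluated on the face of directions A of the cube at v: in its cubical form
    this is a sum over the monotone edge paths of the face. *)
Fixpoint cup l A v : bool :=
  if l is b :: l' then
    \sum_(a in A) (chi b (shift v a) + chi b v) * cup l' (A :\ a) (shift v a)
  else 1.

Lemma bool_addxx (x : bool) : x + x = 0. Proof. by case: x. Qed.

(** In characteristic 2 the pairs (a, b) and (b, a) cancel each other. *)
Lemma sum_sym_pairs A (f : I -> I -> bool) :
  (forall a b, f a b = f b a) -> \sum_(a in A) \sum_(b in A :\ a) f a b = 0.
Proof.
move=> fC; pose lt (a b : I) := (enum_rank a < enum_rank b)%N.
have -> : \sum_(a in A) \sum_(b in A :\ a) f a b =
  \sum_(a in A) \sum_(b in A) (if lt a b then f a b else 0) +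
  \sum_(a in A) \sum_(b in A) (if lt b a then f a b else 0).
  rewrite -big_split; apply: eq_bigr => a aA /=.
  rewrite -big_split /= [RHS](bigID (fun b => b != a)) /=.
  rewrite [X in _ = _ + X]big1 ?addr0; last first.
    by move=> b /andP[_ /negPn/eqP->]; rewrite /lt ltnn addr0.
  apply: eq_big => [b|b]; first by rewrite !inE andbC.
  rewrite !inE => /andP[ba _]; rewrite /lt.
  case: ltngtP => [_|_|e]; rewrite ?addr0 ?add0r //.
  by move/val_inj: e => /enum_rank_inj e; rewrite e eqxx in ba.
rewrite [X in _ + X]exchange_big /=.
under [X in _ + X]eq_bigr do under eq_bigr do rewrite fC.
exact: bool_addxx.
Qed.

Lemma shiftC v a b : shift (shift v a) b = shift (shift v b) a.
Proof. by apply: funext => j; rewrite /shift addnAC. Qed.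

Lemma setD1C A a b : A :\ a :\ b = A :\ b :\ a.
Proof. by rewrite !finset.setDDl finset.setUC. Qed.

Lemma exchange_D1 A (f : I -> I -> bool) :
  \sum_(a in A) \sum_(b in A :\ a) f a b =
  \sum_(b in A) \sum_(a in A :\ b) f a b.
Proof.
rewrite (exchange_big_dep (mem A)) /=; last by move=> a b aA /setD1P[].
apply: eq_bigr => b bA; apply: eq_bigl => a.
by rewrite !inE bA andbT eq_sym andbC.
Qed.

(** A cup product of coboundaries is a cocycle: the values on opposite facets
    of a face add up to 0. Expanding one factor, the terms that go along two
    directions cancel by symmetry, and the other ones by induction. *)
Lemma cup_cocycle l : forall A v,
  \sum_(a in A) (cup l (A :\ a) (shift v a) + cup l (A :\ a) v) = 0.
Proof.
elim: l => [|c l IH] A v; first by rewrite big1 // => a _; exact: bool_addxx.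
have IH' B u : \sum_(a in B) cup l (B :\ a) (shift u a) =
    \sum_(a in B) cup l (B :\ a) u.
  apply/eqP; rewrite -subr_eq0; apply/eqP.
  by rewrite -sumrB -[RHS](IH B u); apply: eq_bigr.
have -> : \sum_(a in A) (cup (c :: l) (A :\ a) (shift v a) + cup (c :: l) (A :\ a) v)
  = \sum_(a in A) \sum_(b in A :\ a)
       chi c (shift (shift v a) b) * cup l (A :\ a :\ b) (shift (shift v a) b)
  + \sum_(a in A) \sum_(b in A :\ a)
       chi c (shift v a) * cup l (A :\ a :\ b) (shift (shift v a) b)
  + \sum_(a in A) \sum_(b in A :\ a)
       chi c (shift v b) * cup l (A :\ a :\ b) (shift v b)
  + \sum_(a in A) \sum_(b in A :\ a) chi c v * cup l (A :\ a :\ b) (shift v b).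
  rewrite -!big_split /=; apply: eq_bigr => a _.
  rewrite -!big_split /=; apply: eq_bigr => b _.
  by rewrite !mulrDl !addrA.
rewrite sum_sym_pairs ?add0r; last by move=> a b; rewrite shiftC setD1C.
rewrite [X in _ + X + _]exchange_D1.
have -> : \sum_(b in A) \sum_(a in A :\ b)
       chi c (shift v b) * cup l (A :\ a :\ b) (shift v b) =
   \sum_(a in A) \sum_(b in A :\ a)
       chi c (shift v a) * cup l (A :\ a :\ b) (shift (shift v a) b).
  apply: eq_bigr => b _; rewrite -!mulr_sumr IH'; congr (_ * _).
  by apply: eq_bigr => a _; rewrite setD1C.
rewrite bool_addxx add0r.
have -> : \sum_(a in A) \sum_(b in A :\ a) chi c v * cup l (A :\ a :\ b) (shift v b)
   = chi c v * \sum_(a in A) \sum_(b in A :\ a) cup l (A :\ a :\ b) v.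
  rewrite mulr_sumr; apply: eq_bigr => a _.
  by rewrite -mulr_sumr IH'.
by rewrite sum_sym_pairs ?mulr0 // => a b; rewrite setD1C.
Qed.

(** A factor whose function is constant where v_a is fixed kills the product on
    any face that does not contain the direction a. *)
Lemma cup_eq0 a l : a \in l -> forall A v, a \notin A ->
  (forall u, u a = v a -> chi a u = chi a v) -> cup l A v = 0.
Proof.
elim: l => //= b l IH; rewrite inE => /orP[/eqP<-|al] A v aA ca.
  rewrite big1 // => c cA; rewrite ca ?bool_addxx ?mul0r //.
  by rewrite /shift; case: eqP aA => [->|_ _]; rewrite ?cA ?addn0.
rewrite big1 // => c cA.
have sv : shift v c a = v a.
  by rewrite /shift; case: eqP aA => [->|_ _]; rewrite ?cA ?addn0.
rewrite IH ?mulr0 //; first by rewrite !inE (negPf aA) andbF.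
by move=> u; rewrite sv => uv; rewrite !ca.
Qed.

Variable M : nat.

(** Iterated rather than joint summation, so that the sum can be telescoped in
    one direction at a time. *)
Fixpoint box_sum l (f : (I -> nat) -> bool) v : bool :=
  if l is a :: l' then \sum_(t < M) box_sum l' f (upd v a t) else f v.

Lemma box_sum_upd a t l : a \notin l -> forall f v,
  box_sum l f (upd v a t) = box_sum l (fun u => f (upd u a t)) v.
Proof.
elim: l => //= b l IH; rewrite inE negb_or => /andP[ab al] f v.
apply: eq_bigr => s _; rewrite -IH //; congr box_sum.
apply: funext => j; rewrite /upd.
by case: eqP => // ->; rewrite eq_sym (negPf ab).
Qed.

Lemma box_sumD l f g v :
  box_sum l (fun u => f u + g u) v = box_sum l f v + box_sum l g v.
Proof.
by elim: l v => //= a l IH v; rewrite -big_split; apply: eq_bigr => t _; exact: IH.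
Qed.

Lemma box_sum_sum A l (f : I -> (I -> nat) -> bool) v :
  box_sum l (fun u => \sum_(a in A) f a u) v = \sum_(a in A) box_sum l (f a) v.
Proof.
elim: l v => //= a l IH v; rewrite exchange_big /=; apply: eq_bigr => t _.
exact: IH.
Qed.

Lemma box_sum_eq l f g v : (forall u, f u = g u) -> box_sum l f v = box_sum l g v.
Proof. by move=> fg; congr box_sum; apply: funext. Qed.

Lemma box_sum0 l v : box_sum l (fun=> 0) v = 0.
Proof. by elim: l v => //= a l IH v; rewrite big1. Qed.

Lemma telescope2 (G : nat -> bool) n : \sum_(t < n) (G t.+1 + G t) = G n + G 0%N.
Proof.
elim: n => [|n IH]; first by rewrite big_ord0 bool_addxx.
by rewrite big_ord_recr /= IH; case: (G n.+1); case: (G n); case: (G 0%N).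
Qed.

Lemma box_sum_telescope a l (g : (I -> nat) -> bool) v : uniq l -> a \in l ->
  box_sum l (fun u => g (shift u a) + g u) v =
  box_sum (rem a l) (fun u => g (upd u a M) + g (upd u a 0%N)) v.
Proof.
elim: l v => //= b l IH v /andP[bl ul]; rewrite inE => /orP[/eqP e|al].
  rewrite -e eqxx; have {}bl : a \notin l by rewrite e.
  under eq_bigr => t _ do rewrite box_sum_upd // box_sumD.
  rewrite box_sumD -(telescope2 (fun t => box_sum l (fun u => g (upd u a t)) v)).
  apply: eq_bigr => t _; congr (_ + _); apply: box_sum_eq => u; congr g.
  by apply: funext => j; rewrite /shift /upd; case: eqP; rewrite ?addn1 ?addn0.
have ba : b != a by apply: contraNneq bl => ->.
by rewrite (negPf ba) /=; apply: eq_bigr => t _; exact: IH.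
Qed.

(** Stokes: by the cocycle property, the sum of the product is a sum over the
    boundary of the box. The facets with a <> a0 do not contribute, since
    [chi a] is constant on them, nor does the facet v_a0 = 0, where [chi a0] is
    0. The facet v_a0 = M gives the same sum in one dimension less. *)
Lemma cup_box_sum l v : uniq l ->
  (forall a u, a \in l -> u a = 0%N -> chi a u = false) ->
  (forall a u, a \in l -> u a = M -> chi a u = true) ->
  box_sum l (cup l [set x in l]) v = true.
Proof.
elim: l v => // a0 l IH v /[dup] ull /= /andP[a0l ul] chi0 chiM.
set A := [set x in _].
pose g a u := chi a0 u * cup l (A :\ a) u.
have -> : \sum_(t < M) box_sum l (fun v0 => \sum_(a in A)
     (chi a0 (shift v0 a) + chi a0 v0) * cup l (A :\ a) (shift v0 a)) (upd v a0 t)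
  = box_sum (a0 :: l) (fun u => \sum_(a in A) (g a (shift u a) + g a u)) v.
  rewrite /=; apply: eq_bigr => t _; apply: box_sum_eq => u.
  have /(congr1 (fun x => chi a0 u * x)) := cup_cocycle l A u.
  rewrite mulr0 mulr_sumr => h0; rewrite -[LHS]addr0 -[X in _ + X = _]h0 -big_split.
  apply: eq_bigr => a _ /=; rewrite /g.
  by case: chi; case: chi; case: cup; case: cup.
rewrite box_sum_sum (bigD1 a0); last by rewrite inE mem_head.
rewrite big1; last first.
  move=> a /andP[]; rewrite inE => al a0a.
  rewrite (box_sum_telescope (g a) _ ull al) -[RHS](box_sum0 (rem a (a0 :: l)) v).
  apply: box_sum_eq => u; rewrite /g.
  have al' : a \in l by move: al; rewrite inE (negPf a0a).
  rewrite !(cup_eq0 al') ?mulr0 //; first by rewrite !inE eqxx.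
  - by move=> u'; rewrite {1}/upd eqxx => /chi0->//; rewrite chi0 // /upd eqxx.
  - by rewrite !inE eqxx.
  - by move=> u'; rewrite {1}/upd eqxx => /chiM->//; rewrite chiM // /upd eqxx.
rewrite [LHS]addr0 (box_sum_telescope (g a0)) ?mem_head //.
rewrite /= eqxx.
rewrite (_ : box_sum _ _ _ = box_sum l (cup l [set x in l]) (upd v a0 M)); last first.
  rewrite box_sum_upd //; apply: box_sum_eq => u; rewrite /g.
  have -> : A :\ a0 = [set x in l].
    by apply/setP => x; rewrite !inE; case: eqP => //= ->; rewrite (negPf a0l).
  rewrite chiM ?mem_head //; last by rewrite /upd eqxx.
  rewrite chi0 ?mem_head //; last by rewrite /upd eqxx.
  by rewrite mul1r mul0r addr0.
by apply: IH => // a u al; [apply: chi0|apply: chiM]; rewrite inE al orbT.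
Qed.

Lemma box_sum_witness l f v : box_sum l f v = true -> exists u, f u = true.
Proof.
elim: l v => [|a l IH] v /=; first by exists v.
move=> h; apply: contrapT => /forallNP fn.
suff : \sum_(t < M) box_sum l f (upd v a t) = 0 by rewrite h.
rewrite big1 // => t _; apply/negbTE/negP => /IH[u /fn]; exact.
Qed.

Lemma cup_witness l A v : cup l A v = true -> forall a, a \in l ->
  exists u1 u2, [/\ forall j, (v j <= u1 j <= v j + (j \in A))%N,
    forall j, (v j <= u2 j <= v j + (j \in A))%N & chi a u1 != chi a u2].
Proof.
elim: l A v => // b l IH A v /= h a al.
have [c cA /andP[chic cupc]] : exists2 c, c \in A &
    (chi b (shift v c) + chi b v) && cup l (A :\ c) (shift v c).
  apply: contrapT => hn; suff : cup (b :: l) A v = 0 by rewrite /= h.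
  rewrite /= big1 // => c cA; apply/negbTE/negP => hc; apply: hn; by exists c.
move: al; rewrite inE => /orP[/eqP->|al].
  exists (shift v c), v; split=> [j|j|].
  - by rewrite /shift leq_addr leq_add2l; case: eqP => // ->; rewrite cA.
  - by rewrite leqnn leq_addr.
  - by move: chic; case: chi; case: chi.
have [u1 [u2 [h1 h2 h12]]] := IH _ _ cupc a al.
exists u1, u2; split=> // j; [move: (h1 j)|move: (h2 j)]; rewrite /shift !inE;
  case: (eqVneq j c) => [->|] /=; rewrite ?cA ?addn0 //; lia.
Qed.

(** Discrete Poincare-Miranda theorem: when [chi a] separates the two facets
    orthogonal to a, for every a, all these functions change in one and the
    same unit cube, because the sum of their product is odd. *)
Lemma cubical_miranda :
  (forall a u, u a = 0%N -> chi a u = false) ->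
  (forall a u, u a = M -> chi a u = true) ->
  exists v, forall a, exists u1 u2,
    [/\ forall j, (v j <= u1 j <= (v j).+1)%N,
        forall j, (v j <= u2 j <= (v j).+1)%N & chi a u1 != chi a u2].
Proof.
move=> chi0 chiM.
have [//|//|v hv] := box_sum_witness (@cup_box_sum (enum I) (fun=> 0%N) (enum_uniq _) _ _).
  by move=> a u _; exact: chi0.
  by move=> a u _; exact: chiM.
exists v => a; have [|u1 [u2 [h1 h2 h12]]] := cup_witness hv (a := a); first by rewrite mem_enum.
by exists u1, u2; split=> // j; [move: (h1 j)|move: (h2 j)]; case: (j \in _); lia.
Qed.

End Miranda.

(** Lebesgue covering theorem: separated sets of bounded width, in as many
    colours as there are directions, cannot cover a large grid. The pieces of
    the colour a are the classes of [key a], and they need only be bounded in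
    the direction a. Take for [chi a] the indicator of the complement of the
    1-neighbourhood of the facet p_a = 0 and of the pieces of colour a that
    come within 1 of it. It does not change in a cube whose lowest corner has
    the colour a, so the lowest corner of the cube given by [cubical_miranda]
    has no colour. *)
Lemma lebesgue_grid (I : finType) (K : Type)
    (S : I -> (I -> nat) -> Prop) (key : I -> (I -> nat) -> K) :
  (forall a p q, S a p -> S a q ->
     (forall j, (p j <= q j + 2)%N /\ (q j <= p j + 2)%N) -> key a p = key a q) ->
  (forall a, exists D, forall p q, S a p -> S a q -> key a p = key a q ->
     (p a <= q a + D)%N) ->
  exists v, forall a, ~ S a v.
Proof.
move=> adj /choice[D bdd].
pose Z a z := z a = 0%N \/
  exists q, [/\ S a z, S a q, key a z = key a q & (q a <= 1)%N].
pose near (u z : I -> nat) := forall j, (u j <= (z j).+1)%N /\ (z j <= (u j).+1)%N.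
pose chi a (u : I -> nat) := ~~ `[< exists2 z, Z a z & near u z >].
(* A piece that comes within 1 of one facet reaches at most max D + 1, whereas a
   neighbour of the opposite facet is at least at max D + 2. *)
have [|a u ua|v hv] := @cubical_miranda I chi (\max_a D a + 3)%N.
- move=> a u ua; apply/negPn/asboolP; exists u; first by left.
  by move=> j; split.
- apply/asboolPn => -[z [za|[q [Sz Sq zq qa]]] /(_ a)]; rewrite ua; first by lia.
  by have := bdd _ _ _ Sz Sq zq; have := @leq_bigmax _ D a; lia.
exists v => a Sv; have [u1 [u2 [h1 h2]]] := hv a.
wlog : u1 u2 h1 h2 / ~~ chi a u1 /\ chi a u2.
  move=> hw; case c1: (chi a u1); case c2: (chi a u2) => // _.
    by apply: (hw u2 u1) => //; rewrite ?c1 ?c2.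
  by apply: (hw u1 u2) => //; rewrite ?c1 ?c2.
move=> [/negPn/asboolP[z Zz nz] /asboolPn c2] _; apply: c2.
exists v; last by move=> j; have := h2 j; lia.
case: Zz => [za|[q [Sz Sq zq qa]]]; right.
  by exists v; split=> //; have := nz a; have := h1 a; lia.
exists q; split=> //; rewrite -zq; apply: adj => // j.
by have := nz j; have := h1 j; lia.
Qed.

(** * Disjoint bounded families *)

Section Families.
Context {R : realType} {X : metricType R}.
Implicit Types (A D U V : set X) (F : set (set X)) (r : R).

Lemma r_disjoint_close r F U V x y : r_disjoint r F -> F U -> F V ->
  U x -> V y -> mdist x y <= r -> U = V.
Proof.
move=> rF FU FV Ux Vy xy; apply: contrapT => UV.
have := rF _ _ FU FV UV; apply/negP; rewrite -leNgt.
by apply: ge_ereal_inf; exists (mdist x y)%:E; [exists (x, y)|rewrite lee_fin].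
Qed.

Lemma uniformly_bounded_ex F : uniformly_bounded F ->
  exists D : R, forall U x y, F U -> U x -> U y -> mdist x y <= D.
Proof.
rewrite /uniformly_bounded; set S := ereal_sup _ => Soo.
have le U x y : F U -> U x -> U y -> ((mdist x y)%:E <= S)%E.
  move=> FU Ux Uy; apply: (@le_trans _ _ (diam U)).
    by apply: ereal_sup_ubound; exists (x, y).
  by apply: ereal_sup_ubound; exists U.
case: S Soo le => [d _ le|//|_ le].
  by exists d => U x y FU Ux Uy; rewrite -lee_fin; exact: le FU Ux Uy.
by exists 0 => U x y FU Ux Uy; have := le _ _ _ FU Ux Uy.
Qed.

Lemma r_disjoint_le r r' F : r' <= r -> r_disjoint r F -> r_disjoint r' F.
Proof.
by move=> r'r rF U V FU FV UV; apply: le_lt_trans (rF U V FU FV UV); rewrite lee_fin.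
Qed.

(** How all the families of the upper bounds are made: as the classes of a
    function on the part D to be covered. The margin of 1 is needed because an
    infimum has to exceed r strictly. *)
Lemma keyed_family A D (K : Type) (key : X -> K) r d : D `<=` A ->
  (forall p q, D p -> D q -> key p = key q -> mdist p q <= d) ->
  (forall p q, D p -> D q -> key p <> key q -> r + 1 <= mdist p q) ->
  exists F, [/\ family_of_subsets A F, uniformly_bounded F, r_disjoint r F
    & family_union F = D].
Proof.
move=> DA near far.
exists [set U | exists2 p, D p & U = [set q | D q /\ key q = key p]]; split.
- by move=> _ [p Dp ->] q [/DA].
- apply: (@le_lt_trans _ _ d%:E); last exact: ltry.
  apply: ge_ereal_sup => _ [_ [p Dp ->] <-].
  apply: ge_ereal_sup => _ [[q q'] [[/= Dq qp] [/= Dq' q'p]] <-].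
  by rewrite lee_fin; apply: near => //; rewrite qp.
- move=> _ _ [p Dp ->] [p' Dp' ->] UV.
  apply: (@lt_le_trans _ _ (r + 1)%:E); first by rewrite lte_fin ltrDl.
  apply: le_ereal_inf_tmp => _ [[q q'] [[/= Dq qp] [/= Dq' q'p]] <-].
  rewrite lee_fin; apply: far => // qq'; apply: UV.
  by rewrite -qp -q'p qq'.
- apply/seteqP; split=> [q [_ [p Dp ->] []//]|q Dq].
  by exists [set q' | D q' /\ key q' = key q] => //; exists q.
Qed.

End Families.

(** * Kolmogorov's trick on the line *)

Section Kolmogorov.
Variables (P s : int).
Hypotheses (P_gt0 : 0 < P) (s_gt0 : 0 < s).

(** Gaps are open, so that a multiple of the period P is in no gap, not even of
    the colour 0. The intervals of the colour t are the components of the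
    complement of its gaps. *)
Definition gap (t : nat) (z : int) : Prop :=
  exists b : int, b * P + t%:Z * s < z < b * P + (t%:Z + 1) * s.

(** The index of the interval of colour t that contains z. *)
Definition cell (t : nat) (z : int) : int := ((z - (t%:Z + 1) * s) %/ P)%Z.

Lemma mul_step (m n : int) : m < n -> m * s + s <= n * s.
Proof. by move=> mn; rewrite -[X in _ + X]mul1r -mulrDl ler_pM2r //; lia. Qed.

Lemma mul_period (m n : int) : m < n -> m * P + P <= n * P.
Proof. by move=> mn; rewrite -[X in _ + X]mul1r -mulrDl ler_pM2r //; lia. Qed.

Lemma gap_zone N t z : (t < N)%N -> gap t z ->
  exists b : int, b * P < z < b * P + N%:Z * s.
Proof.
move=> tN [b /andP[z1 z2]]; exists b.
have t0 : 0 <= t%:Z * s by rewrite mulr_ge0 // ltW.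
have := @mul_step t N; rewrite mulrDl mul1r in z2.
lia.
Qed.

Lemma block_unique (b b' z : int) :
  b * P < z < b * P + P -> b' * P < z < b' * P + P -> b = b'.
Proof.
move=> h h'; have := @mul_period b b'; have := @mul_period b' b.
lia.
Qed.

Lemma gap_inj N t t' z : N%:Z * s <= P -> (t < N)%N -> (t' < N)%N ->
  gap t z -> gap t' z -> t = t'.
Proof.
move=> NP tN tN' gt gt'.
have [b hb] := gap_zone tN gt; have [b' hb'] := gap_zone tN' gt'.
case: gt gt' => [c hc] [c' hc'].
have t0 : 0 <= t%:Z * s by rewrite mulr_ge0 // ltW.
have t0' : 0 <= t'%:Z * s by rewrite mulr_ge0 // ltW.
have := @mul_step t N; have := @mul_step t' N.
rewrite !mulrDl !mul1r in hc hc' => h1 h2.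
have cc' : c = c' by apply: (@block_unique _ _ z); lia.
subst c'; have := @mul_step t t'; have := @mul_step t' t.
lia.
Qed.

Lemma gap_multiple N t b : N%:Z * s <= P -> (t < N)%N -> ~ gap t (b * P).
Proof.
move=> NP tN /(gap_zone tN)[b' h].
have := @mul_period b b'; have := @mul_period b' b.
case: (ltgtP b b') => [bb'|b'b|e]; first by lia.
  have := @mul_period b' b; lia.
by subst b'; lia.
Qed.

Lemma cell_bounds t z : ~ gap t z ->
  cell t z * P + (t%:Z + 1) * s <= z <= (cell t z + 1) * P + t%:Z * s.
Proof.
move=> ngap; rewrite /cell; set u := z - _.
have := divz_eq u P; have := modz_ge0 u (lt0r_neq0 P_gt0).
have := ltz_pmod u P_gt0; set q := (u %/ P)%Z; set m := (u %% P)%Z.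
move=> mP m0 uE; have zE : z = q * P + m + (t%:Z + 1) * s by rewrite -uE /u; ring.
rewrite zE; apply/andP; split; first by lia.
rewrite leNgt; apply/negP => h; apply: ngap; exists (q + 1).
by rewrite zE h /= mulrDl mul1r; lia.
Qed.

Lemma cell_near t z z' : ~ gap t z -> ~ gap t z' -> cell t z = cell t z' ->
  `|z - z'| <= P.
Proof.
move=> /cell_bounds h /cell_bounds h' e; rewrite e in h.
move: h h'; rewrite !mulrDl !mul1r; lia.
Qed.

Lemma cell_far t z z' : ~ gap t z -> ~ gap t z' -> cell t z <> cell t z' ->
  s <= `|z - z'|.
Proof.
move=> /cell_bounds h /cell_bounds h'; set c := cell t z in h *.
set c' := cell t z' in h' *; move=> cc'.
have := @mul_period c c'; have := @mul_period c' c.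
move: h h'; rewrite !mulrDl !mul1r; lia.
Qed.

End Kolmogorov.

(** Each of the n bad coordinates excludes at most one of the n + 1 colours. *)
Lemma pigeonhole (J : eqType) (n : nat) (bad : seq J) (miss : J -> nat -> Prop) :
  (size bad <= n)%N -> (forall j c, (c <= n)%N -> miss j c -> j \in bad) ->
  (forall j c c', (c <= n)%N -> (c' <= n)%N -> miss j c -> miss j c' -> c = c') ->
  exists2 c, (c <= n)%N & forall j, ~ miss j c.
Proof.
move=> badn missB missI; apply: contrapT => h.
have /choice[f fP] (c : 'I_n.+1) : exists j, miss j c.
  apply: contrapT => hj; apply: h; exists c => [|j mj]; first exact: (ltn_ord c).
  by apply: hj; exists j.
suff : (n < size bad)%N by rewrite ltnNge badn.
rewrite -[X in (X <= _)%N](size_enum_ord n.+1) -(size_map f); apply: uniq_leq_size.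
  rewrite map_inj_uniq ?enum_uniq // => c c' cc'; apply/val_inj.
  apply: (missI (f c)); [exact: (ltn_ord c)|exact: (ltn_ord c')|exact: fP|].
  by rewrite cc'; exact: fP.
by move=> _ /mapP[c _ ->]; exact: missB (ltn_ord c) (fP c).
Qed.

(** * Coverings of the space *)

Lemma as_gap_ge l k : l <> k -> (maxn l k <= (as_gap l k).+1)%N.
Proof.
wlog lk : l k / (l < k)%N => [hw lk|_].
  have /orP[/hw|/hw] : (l < k)%N || (k < l)%N by lia.
    by apply.
  by rewrite maxnC as_gapC; apply; apply/nesym.
rewrite /as_gap (minn_idPl (ltnW lk)) (maxn_idPr (ltnW lk)).
by case: k lk => // k lk; rewrite big_nat_recr //= ltnS leq_addl.
Qed.

Lemma as_gap_le l k K : (l < K)%N -> (k < K)%N -> (as_gap l k <= K * K)%N.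
Proof.
wlog lk : l k / (l <= k)%N => [hw lK kK|lK kK].
  have /orP[/hw|/hw] : (l <= k)%N || (k <= l)%N by lia.
    by apply.
  by rewrite as_gapC; apply.
rewrite /as_gap (minn_idPl lk) (maxn_idPr lk).
apply: (@leq_trans (\sum_(l <= j < k) K)).
  by rewrite !big_nat; apply: leq_sum => j; lia.
by rewrite sum_nat_const_nat leq_mul2r; lia.
Qed.

(** The distance between different summands is controlled only from some
    index on, so the first ones have to be put together. *)
Definition head_collapse (i0 : nat) (i : posnat) : nat := if (i < i0)%N then 0%N else i.

Lemma head_collapse_near i0 (i i' : posnat) :
  head_collapse i0 i = head_collapse i0 i' -> (as_gap i i' <= i0 * i0)%N.
Proof.
rewrite /head_collapse; case: ltnP => ii; case: ltnP => ii' e.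
- exact: as_gap_le.
- by have := valP i'; rewrite /= -e.
- by have := valP i; rewrite /= e.
- by rewrite e as_gapxx.
Qed.

Lemma head_collapse_far i0 (i i' : posnat) :
  head_collapse i0 i <> head_collapse i0 i' -> (i0 <= (as_gap i i').+1)%N.
Proof.
move=> ne; have /as_gap_ge : i <> i' :> nat.
  by move=> e; apply: ne; rewrite /head_collapse e.
have : (i0 <= maxn i i')%N.
  by move: ne; rewrite /head_collapse leq_max; case: (ltnP i i0); case: (ltnP i' i0).
by lia.
Qed.

Section Space.
Variable R : realType.
Notation V := (direct_sum R).
Notation X := (as_copies (as_copies V)).
Implicit Types (p q : X).

Definition posn (n : nat) : posnat := @Posnat n.+1 isT.

Lemma mdistE p q : mdist p q =
  max_dist p.2.2 q.2.2 + (as_gap p.2.1 q.2.1)%:R + (as_gap p.1 q.1)%:R.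
Proof. by []. Qed.

Lemma max_dist_ge0 (x y : V) : 0 <= max_dist x y.
Proof. exact: le_trans (max_dist_ge x y (posn 0)). Qed.

Lemma mdist_ge_coord p q j : `|p.2.2 j - q.2.2 j| <= mdist p q.
Proof.
rewrite mdistE; have := max_dist_ge p.2.2 q.2.2 j.
have := ler0n R (as_gap p.2.1 q.2.1); have := ler0n R (as_gap p.1 q.1); lra.
Qed.

Lemma mdist_ge_gap1 p q : (as_gap p.1 q.1)%:R <= mdist p q.
Proof.
rewrite mdistE; have := max_dist_ge0 p.2.2 q.2.2.
have := ler0n R (as_gap p.2.1 q.2.1); lra.
Qed.

Lemma mdist_ge_gap2 p q : (as_gap p.2.1 q.2.1)%:R <= mdist p q.
Proof.
rewrite mdistE; have := max_dist_ge0 p.2.2 q.2.2.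
have := ler0n R (as_gap p.1 q.1); lra.
Qed.

Lemma pow2Z0 k : pow2Z k (0 : R).
Proof. by exists 0 => //; rewrite mulr0. Qed.

Lemma pow2Z_le k k' (x : R) : (k' <= k)%N -> pow2Z k x -> pow2Z k' x.
Proof.
move=> kk' [m _ <-]; exists (2 ^+ (k - k') * m) => //.
by rewrite intrM rmorphXn /= mulrA -exprD subnKC.
Qed.

Lemma pow2Z_floor k (x : R) : pow2Z k x ->
  exists2 m : int, Num.floor x = m * 2 ^+ k & x = (Num.floor x)%:~R.
Proof.
move=> [m _ <-]; have -> : 2 ^+ k * m%:~R = (m * 2 ^+ k)%:~R :> R.
  by rewrite intrM rmorphXn /= mulrC.
by exists m; rewrite intrKfloor.
Qed.

Lemma Y_coord p j : Y_2omega R p -> pow2Z p.1 (p.2.2 j).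
Proof.
move=> [/= px pk _]; have [ji|ij] := leqP j p.2.1; first exact: pk.
by rewrite px //; exact: pow2Z0.
Qed.

(** Kolmogorov's trick: gaps of width s and period 2^e, for n + 1 colours.
    Two points of one colour with different keys are either in pieces i far
    apart or in different boxes. Boxes with the same index in all the finitely
    many spaces k < k0 are put together. *)
Lemma colour_cover (B : set X) (k0 n i0 e s : nat) (r : R) :
  B `<=` Y_2omega R -> (forall p, B p -> (p.1 < k0)%N) ->
  (n.+1 * s <= 2 ^ e)%N -> 0 < r -> r + 1 <= s%:R -> r + 2 <= i0%:R ->
  (forall p, B p -> exists2 bad : seq posnat, (size bad <= n)%N &
     forall j, j \notin bad -> pow2Z e (p.2.2 j)) ->
  exists F : 'I_n.+1 -> set (set X),
    (forall c, [/\ family_of_subsets B (F c), uniformly_bounded (F c)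
                & r_disjoint r (F c)]) /\
    B `<=` \bigcup_c family_union (F c).
Proof.
move=> BY Bk nsP r0 rs ri Bbad.
pose P : int := 2 ^+ e; pose z p j := Num.floor (p.2.2 j).
have zE p j : B p -> p.2.2 j = (z p j)%:~R.
  by move=> /BY/Y_coord => /(_ j)/pow2Z_floor[].
have PE : P = (2 ^ e)%N%:Z by rewrite /P -natz natrX.
have P0 : 0 < P by rewrite exprn_gt0.
have s0 : 0 < s%:Z.
  have : 0 < s%:R :> R by lra.
  by rewrite ltr0n.
pose D (c : 'I_n.+1) := [set p | B p /\ forall j, ~ gap P s c (z p j)].
pose key (c : 'I_n.+1) p := (head_collapse i0 p.2.1, fun j => cell P s c (z p j)).
have /choice[F FP] c : exists F, [/\ family_of_subsets B F, uniformly_bounded F,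
    r_disjoint r F & family_union F = D c].
  apply: (@keyed_family _ _ _ _ _ (key c) _ (P%:~R + (i0 * i0)%:R + (k0 * k0)%:R)).
  - by move=> p [].
  - move=> p q [Bp np] [Bq nq] [eqi eqc]; rewrite mdistE.
    have h1 : max_dist p.2.2 q.2.2 <= P%:~R.
      apply: max_dist_le => [|j]; first by rewrite ler0z ltW.
      rewrite !zE // -intrB -intr_norm ler_int.
      by apply: (cell_near P0 s0 (np j) (nq j)); exact: (congr1 (@^~ j) eqc).
    have h2 := head_collapse_near eqi.
    have h3 : (as_gap p.1 q.1 <= k0 * k0)%N by apply: as_gap_le; exact: Bk.
    by rewrite -(ler_nat R) in h2; rewrite -(ler_nat R) in h3; lra.
  - move=> p q [Bp np] [Bq nq] kpq.
    have [eqi|/eqP nei] := eqVneq (head_collapse i0 p.2.1) (head_collapse i0 q.2.1).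
      have [j cj] : exists j, cell P s c (z p j) <> cell P s c (z q j).
        apply: contrapT => /forallNP h; apply: kpq; rewrite /key eqi; congr pair.
        by apply: funext => j; have /contrapT := h j.
      apply: le_trans (mdist_ge_coord p q j); apply: le_trans rs _.
      rewrite !zE // -intrB -intr_norm -[s%:R]/((s%:Z)%:~R) ler_int.
      exact: (cell_far P0 s0 (np j) (nq j) cj).
    apply: le_trans (mdist_ge_gap2 p q).
    have := head_collapse_far nei; rewrite -(ler_nat R) -natr1 => h; lra.
exists F; split=> [c|p Bp]; first by have [] := FP c.
have [bad badn badP] := Bbad p Bp.
have nsP' : n.+1%:Z * s%:Z <= P by rewrite PE; lia.
have [||c cn cP] := @pigeonhole _ n bad (fun j c => gap P s c (z p j)) badn.
- move=> j c cn gj; apply: contraPT gj => /badP/pow2Z_floor[m mE _].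
  by rewrite /z mE; apply: (gap_multiple P0 s0 nsP').
- by move=> j c c' cn cn'; apply: (gap_inj P0 s0 nsP').
exists (Ordinal (cn : (c < n.+1)%N)) => //.
by have [_ _ _ ->] := FP (Ordinal (cn : (c < n.+1)%N)).
Qed.

Lemma nat_above (r : R) : exists m : nat, r + 2 <= m%:R.
Proof.
exists (Num.trunc r + 3)%N.
have := truncnS_gt r; rewrite natrD -natr1; lra.
Qed.

Lemma bad_of_card (A : set posnat) n : A #<= `I_n ->
  exists2 bad : seq posnat, (size bad <= n)%N & forall j, j \notin bad -> ~ A j.
Proof.
move=> An; exists (fset_set A); first exact: geq_card_fset_set.
have finA : finite_set A by apply/finite_set_leP; exists n.
by move=> j; apply: contraNnot => Aj; rewrite in_fset_set // inE.
Qed.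

(** With i < i0 at most i0 coordinates are nonzero, whatever the period is, so
    the number of families does not depend on the scale. *)
Lemma cover_finite (B : set X) (k0 i0 : nat) (r : R) : 0 < r ->
  B `<=` Y_2omega R -> (forall p, B p -> (p.1 < k0)%N) ->
  (forall p, B p -> (p.2.1 < i0)%N) ->
  exists F : 'I_i0.+1 -> set (set X),
    (forall c, [/\ family_of_subsets B (F c), uniformly_bounded (F c)
                & r_disjoint r (F c)]) /\
    B `<=` \bigcup_c family_union (F c).
Proof.
move=> r0 BY Bk Bi; have [s rs] := nat_above r.
apply: (@colour_cover B k0 i0 s (i0.+1 * s) s r) => //; last 1 first.
- move=> p Bp; exists [seq posn j | j <- iota 0 i0]; first by rewrite size_map size_iota.
  move=> j jbad; rewrite (_ : p.2.2 j = 0); first exact: pow2Z0.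
  have [px _ _] := BY p Bp; apply: px; rewrite ltnNge; apply: contra jbad => ji.
  apply/mapP; exists j.-1; last by apply/val_inj; rewrite /= prednK //; exact: (valP j).
  by rewrite mem_iota add0n /=; have := Bi p Bp; move: ji; clear; case: j => j /=; lia.
- by apply: ltnW; exact: ltn_expl.
- lra.
Qed.

(** Once 2^i is a multiple of the period, a coordinate in 2^i Z is not bad: a
    point has at most k <= k0 bad coordinates, whatever i is. *)
Lemma cover_skeleta (k0 : nat) (r : R) : 0 < r -> exists i0,
  exists F : 'I_k0.+1 -> set (set X),
    (forall c, [/\ family_of_subsets [set p | Y_2omega R p /\ (p.1 < k0)%N] (F c),
       uniformly_bounded (F c) & r_disjoint r (F c)]) /\
    forall p, Y_2omega R p -> (p.1 < k0)%N -> (i0 <= p.2.1)%N ->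
      (\bigcup_c family_union (F c)) p.
Proof.
move=> r0; have [s rs] := nat_above r.
pose i0 := (k0.+1 * s)%N; exists i0.
have [|||||||F [FP Fcov]] := @colour_cover
    [set p | [/\ Y_2omega R p, (p.1 < k0)%N & (i0 <= p.2.1)%N]] k0 k0 i0 i0 s r.
- by move=> p [].
- by move=> p [].
- by apply: ltnW; exact: ltn_expl.
- by [].
- lra.
- apply: le_trans rs _; rewrite ler_nat /i0; exact: leq_pmull.
- move=> p [Yp pk pi]; have [px pk' pc] := Yp.
  have [bad badk badP] := bad_of_card pc.
  exists bad => [|j /badP nj]; first by apply: leq_trans badk _; exact: ltnW.
  apply: (pow2Z_le pi); apply: contrapT => nij; apply: nj; split=> //.
  rewrite leqNgt; apply/negP => ij; apply: nij; rewrite px //; exact: pow2Z0.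
exists F; split=> [c|p Yp pk pi]; last by apply: Fcov.
have [Fsub Fb Fd] := FP c; split=> // U FU p Up.
by have [] := Fsub _ FU _ Up.
Qed.

(** The vectors of the k-th space are 2^k-separated, so for 2^k above r single
    points already form an r-disjoint family, except that the copies of a vector
    in the first pieces i are close to each other. *)
Lemma cover_large (r : R) : 0 < r -> exists k0,
  exists F : set (set X),
    [/\ family_of_subsets (Y_2omega R) F, uniformly_bounded F, r_disjoint r F &
    family_union F = [set p | Y_2omega R p /\ (k0 <= p.1)%N]].
Proof.
move=> r0; have [k0 rk] := nat_above r; exists k0.
apply: (@keyed_family _ _ _ _ _ (fun p : X => (p.1, head_collapse k0 p.2.1, p.2.2)) _ (k0 * k0)%:R).
- by move=> p [].
- move=> p q _ _ [e1 eqi e2]; rewrite mdistE e1 as_gapxx e2 addr0.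
  rewrite (mdistxx (q.2.2 : V) : max_dist _ _ = 0) add0r ler_nat.
  exact: head_collapse_near.
- move=> p q [Yp pk] [Yq qk] kpq.
  have gapP m : (k0 <= m.+1)%N -> r + 1 <= m%:R by rewrite -(ler_nat R) -natr1 => h3; lra.
  have [e1|ne1] := eqVneq p.1 q.1; last first.
    apply: le_trans (mdist_ge_gap1 p q); apply: gapP.
    have : p.1 <> q.1 :> nat by move=> /val_inj e; rewrite e eqxx in ne1.
    by move/as_gap_ge; apply: leq_trans; rewrite leq_max pk.
  have [eqi|/eqP nei] := eqVneq (head_collapse k0 p.2.1) (head_collapse k0 q.2.1); last first.
    apply: le_trans (mdist_ge_gap2 p q); apply: gapP.
    exact: head_collapse_far.
  have [j pqj] : exists j, p.2.2 j <> q.2.2 j.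
    apply: contrapT => /forallNP h; apply: kpq; rewrite e1 eqi; congr (_, _, _).
    by apply/fsfunP => j; have /contrapT := h j.
  apply: le_trans (mdist_ge_coord p q j).
  have [m _ mp] := Y_coord j Yp; have [m' _ mq] := Y_coord j Yq.
  rewrite -mp -mq -e1 in pqj *; rewrite -mulrBr normrM.
  have mm' : (1 : R) <= `|m%:~R - m'%:~R|.
    rewrite -intrB -intr_norm -[1]/(1%:~R) ler_int.
    have : m <> m' by move=> mm'; apply: pqj; rewrite mm'.
    by clear; lia.
  have : k0%:R <= `|2 ^+ p.1| :> R.
    rewrite ger0_norm ?exprn_ge0 // -natrX ler_nat.
    by apply: leq_trans pk _; apply: ltnW; exact: ltn_expl.
  move=> h; apply: le_trans (_ : k0%:R * 1 <= _); first by lra.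
  by apply: ler_pM.
Qed.

End Space.

(** * Collapsing thickened walls *)

Section Collapse.
Variables (L g : nat).
Hypothesis L_gt0 : (0 < L)%N.
Let P := (L + g)%N.

(** The thickened cubulation of the line consists of walls of width g followed
    by free stretches of length L; collapsing every wall to a point gives the
    multiples of L. *)
Definition collapse (x : nat) : nat := (x %/ P * L + (x %% P - g))%N.

Let P_gt0 : (0 < P)%N. Proof. by rewrite /P addn_gt0 L_gt0. Qed.

Lemma collapse_step x : (collapse x <= collapse x.+1 <= (collapse x).+1)%N.
Proof.
have := ltn_pmod x P_gt0; have := divn_eq x P.
rewrite /collapse; set q := (x %/ P)%N; set t := (x %% P)%N => /(congr1 S) -> tP.
rewrite -addnS; have [e|tP'] := eqVneq t.+1 P.
  rewrite e -mulSnr mulnK // modnMl sub0n addn0 mulSnr.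
  by move: e; rewrite /P; clear; lia.
have tP2 : (t.+1 < P)%N by rewrite ltn_neqAle tP' tP.
by rewrite divnMDl // divn_small // addn0 modnMDl modn_small //; clear; lia.
Qed.

Lemma collapse_lip x y e : (x <= y + e)%N -> (collapse x <= collapse y + e)%N.
Proof.
have up n z : (collapse z <= collapse (z + n) <= collapse z + n)%N.
  elim: n z => [|n IH] z; first by rewrite !addn0 leqnn.
  rewrite addnS; have := IH z; have := collapse_step (z + n); lia.
have [xy|/ltnW yx] := leqP x y => xye.
  by have := up (y - x)%N x; rewrite subnKC //; lia.
by have := up (x - y)%N y; rewrite subnKC //; lia.
Qed.

Lemma collapse_expand x y e : (collapse x <= collapse y + e)%N ->
  (x <= y + (e + 2) * P)%N.
Proof.
rewrite /collapse => h.
have h1 : (y %% P - g <= L)%N by have := ltn_pmod y P_gt0; rewrite /P; lia.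
have h2 : (x %/ P <= y %/ P + 1 + e)%N.
  rewrite -(leq_pmul2r L_gt0); apply: (@leq_trans (y %/ P * L + L + e * L)).
    have : (e <= e * L)%N by rewrite leq_pmulr.
    by move: h h1; clear; lia.
  by clear; lia.
have h3 := ltn_pmod x P_gt0; rewrite (divn_eq x P) [X in (_ <= X + _)%N](divn_eq y P).
have h4 : (x %/ P * P <= (y %/ P + 1 + e) * P)%N by rewrite leq_mul2r h2 orbT.
by move: h3 h4; clear; lia.
Qed.

Lemma collapse_zone x : (x %% P <= g)%N -> collapse x = (x %/ P * L)%N.
Proof. by rewrite /collapse -subn_eq0 => /eqP->; rewrite addn0. Qed.

End Collapse.

(** * The grid of dimension n + m + 2 *)

Section Core.
Variables (R : realType) (n m : nat).
Notation V := (direct_sum R).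
Notation X := (as_copies (as_copies V)).

Let d := (n + m + 1).+1.
Let I := 'I_d.
Let k := posn n.
Let i := posn (n + m + 1).
(* The grid step is 2^k, so that a cube of side 2^i has 2^(i - k) steps. *)
Let L := (2 ^ m.+1)%N.
(* A wall holds the gaps of the m + 1 colours of the boxes. Their width is 3,
   since points of one colour at distance 2 have to be in the same box. *)
Let g := (m.+1 * 3)%N.
Let P := (L + g)%N.
Implicit Types (v w y : I -> nat) (a b : I).

Let L_gt0 : (0 < L)%N. Proof. by rewrite expn_gt0. Qed.

Definition grid_vec v : V :=
  [fsfun j in [fset posn (val a) | a in I]%fset =>
     (2 ^ n.+1 * collapse L g (v (inord (nat_of_posnat j).-1)))%:R | 0].

Lemma grid_vecE v j : grid_vec v j = if (j <= d)%N
   then (2 ^ n.+1 * collapse L g (v (inord (nat_of_posnat j).-1)))%:R else 0.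
Proof.
rewrite fsfunE; congr (if _ then _ else _); apply/imfsetP/idP => [[a _ ->]|jd].
  exact: (ltn_ord a).
have j0 : (0 < j)%N by exact: (valP j).
exists (inord j.-1) => //; apply/val_inj.
by rewrite /= inordK prednK.
Qed.

Lemma grid_vec_coord v a : grid_vec v (posn a) = (2 ^ n.+1 * collapse L g (v a))%:R.
Proof. by rewrite grid_vecE /= ltn_ord inord_val. Qed.

Definition grid_pt v : X := (k, (i, grid_vec v)).

Lemma mdist_grid v w : mdist (grid_pt v) (grid_pt w) = max_dist (grid_vec v) (grid_vec w).
Proof. by rewrite mdistE /= !as_gapxx !addr0. Qed.

Definition within e v w := forall a, (v a <= w a + e)%N /\ (w a <= v a + e)%N.

Lemma within_sym e v w : within e v w -> within e w v.
Proof. by move=> h a; have [] := h a. Qed.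

Lemma within_trans e e' v w y : within e v w -> within e' w y -> within (e + e') v y.
Proof. by move=> h h' a; have := h a; have := h' a; lia. Qed.

Lemma mdist_grid_le v w e : within e v w ->
  mdist (grid_pt v) (grid_pt w) <= (2 ^ n.+1 * e)%:R.
Proof.
move=> vw; rewrite mdist_grid; apply: max_dist_le => // j.
rewrite !grid_vecE; case: leqP => _; last by rewrite subrr normr0.
set a := inord _; have [h1 h2] := vw a.
have /(leq_mul (leqnn (2 ^ n.+1)%N)) := collapse_lip g L_gt0 h1.
have /(leq_mul (leqnn (2 ^ n.+1)%N)) := collapse_lip g L_gt0 h2.
rewrite !mulnDr -!(ler_nat R) !natrD => h3 h4.
by rewrite ler_norml; lra.
Qed.

Lemma mdist_grid_ge v w (D : R) a : mdist (grid_pt v) (grid_pt w) <= D ->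
  (v a <= w a + (Num.trunc D + 3) * P)%N.
Proof.
rewrite mdist_grid => vwD; have := le_trans (max_dist_ge _ _ (posn a)) vwD.
rewrite !grid_vec_coord => /ler_normlW h.
have -> : (Num.trunc D + 3 = (Num.trunc D).+1 + 2)%N by clear; lia.
apply: collapse_expand => //; rewrite -(@leq_pmul2l (2 ^ n.+1)%N) ?expn_gt0 //.
rewrite mulnDr; apply: (@leq_trans (2 ^ n.+1 * collapse L g (w a) + (Num.trunc D).+1)).
  by rewrite -(ler_nat R) natrD; have := truncnS_gt D; lra.
by rewrite leq_add2l leq_pmull // expn_gt0.
Qed.

Definition high v : {set I} := [set a | (g < v a %% P)%N]%SET.

Definition low v := (#|high v| <= n.+1)%N.

(** Coordinates in the walls collapse to 2^i Z. *)
Lemma low_Y v : low v -> Y_2omega R (grid_pt v).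
Proof.
move=> lv; split=> /=.
- by move=> j /= dj; rewrite grid_vecE leqNgt dj.
- move=> j _; rewrite grid_vecE; case: leqP => _; last exact: pow2Z0.
  exists (collapse L g (v (inord (nat_of_posnat j).-1)))%:Z => //=.
  by rewrite natrM natrX.
- set s := [seq posn (val a) | a <- enum (high v)].
  apply: (@card_le_trans _ _ _ ((fun t => nth (posn 0) s t) @` `I_(n.+1))).
  apply: subset_card_le => j [/= jd njd].
  have js : j \in s.
    have jE : j = posn (val (inord j.-1 : I)).
      have j0 : (0 < j)%N by exact: (valP j).
      by apply/val_inj; rewrite /= inordK prednK.
    rewrite {1}jE; apply: map_f; rewrite mem_enum inE.
    rewrite ltnNge; apply/negP => /collapse_zone zone; apply: njd.
    rewrite grid_vecE; case: leqP => _; last exact: pow2Z0.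
    rewrite zone; exists (v (inord j.-1) %/ P)%:Z => //=.
    rewrite natrM /L natrM !natrX mulrCA mulrC -exprD.
    by congr (_ * 2 ^+ _); rewrite /=; clear; lia.
  have sn : (size s <= n.+1)%N by rewrite size_map -cardE.
  exists (index j s); last exact: nth_index.
  by rewrite /=; apply: leq_trans sn; rewrite index_mem.
  exact: card_image_le.
Qed.

Definition avoids (t : nat) v := forall a, ~ gap P 3 t (v a).
Definition box_of (t : nat) v : I -> int := fun a => cell P 3 t (v a).

Let gP : m.+1%:Z * 3 <= P%:Z.
Proof. by rewrite /P /g; lia. Qed.
Let P0 : 0 < P%:Z.
Proof. by rewrite ltz_nat /P addn_gt0 L_gt0. Qed.
Let s0 : 0 < 3%:Z. Proof. by []. Qed.

(** A point that is not low has at most m coordinates in the walls, hence at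
    most m bad ones for the m + 1 colours of boxes. *)
Lemma low_or_avoids v : low v \/ exists2 t, (t <= m)%N & avoids t v.
Proof.
rewrite /low; case: leqP => out; [by left|right].
have [|||t tm tv] := @pigeonhole _ m (enum (~: high v))
    (fun a t => gap P 3 t (v a)).
- rewrite -cardE; have := cardsC (high v).
  by rewrite card_ord; move: out; rewrite /d; clear; lia.
- move=> a t tm gat; rewrite mem_enum !inE -leqNgt leqNgt; apply/negP => oz.
  have [b hb] := gap_zone P0 s0 (tm : (t < m.+1)%N) gat.
  have va : ((v a)%:Z = (v a %/ P)%N%:Z * P%:Z + (v a %% P)%N%:Z).
    by rewrite -PoszM -PoszD -divn_eq.
  have vP : (v a %% P < P)%N by rewrite ltn_pmod // /P addn_gt0 L_gt0.
  have bE : b = (v a %/ P)%N.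
    apply: (@block_unique P%:Z 3%:Z P0 s0 b _ (v a)%:Z);
      move: hb oz va vP gP; rewrite /g; clear; lia.
  by subst b; move: hb oz va; rewrite /g; clear; lia.
- by move=> a t t' tm tm'; apply: (gap_inj P0 s0 gP).
by exists t.
Qed.

Lemma box_of_adj t v w : avoids t v -> avoids t w -> within 2 v w ->
  box_of t v = box_of t w.
Proof.
move=> av aw vw; apply: funext => a; apply: contrapT => /(cell_far P0 s0 (av a) (aw a)).
by have := vw a; clear; lia.
Qed.

Lemma box_of_within t v w : avoids t v -> avoids t w ->
  box_of t v = box_of t w -> within P v w.
Proof.
move=> av aw vw a; have := cell_near P0 s0 (av a) (aw a) (congr1 (@^~ a) vw).
by clear; lia.
Qed.

(* The families with index at most n are the fine ones. The index of a family
   is also the direction in which the covering theorem bounds its members. *)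
Variables (F : I -> set (set X)) (r r' : R).
Hypothesis F_fine : forall a, r_disjoint r (F a).
Hypothesis F_coarse : forall a, (n < a)%N -> r_disjoint r' (F a).
Hypothesis F_bounded : forall a, uniformly_bounded (F a).
Hypothesis F_cover : forall p, Y_2omega R p -> exists a, family_union (F a) p.
Hypothesis r_ge : (2 ^ n.+1 * 2)%:R <= r.
Hypothesis r'_ge : (2 ^ n.+1 * (2 * P + 6))%:R <= r'.

(** Only the coarse colours can absorb boxes: r is smaller than a box. *)
Definition boxed a v := (n < a)%N /\ avoids (a - n.+1) v.

(** The grid point v belongs to the piece of colour a built around W: either
    its image is in W, or its box touches a point whose image is in W. In the
    latter case the whole box is attached, so that a box is never split. *)
Definition attached a v (W : set X) := F a W /\
  ((low v /\ W (grid_pt v)) \/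
   (boxed a v /\ exists y y', [/\ low y, W (grid_pt y), boxed a y',
      box_of (a - n.+1) y' = box_of (a - n.+1) v & within 2 y y'])).

Definition coloured a v := (exists W, attached a v W) \/ boxed a v.

(** A piece is a member of the family with the boxes attached to it, or else
    a single box. *)
Definition colour_key a v : set X + (I -> int) :=
  if pselect (exists W, attached a v W) is left ex then inl (sval (cid ex))
  else inr (box_of (a - n.+1) v).

Lemma attached_near a v W : attached a v W ->
  exists y, [/\ low y, W (grid_pt y), within (P + 2) v y & ~~ (n < a)%N -> y = v].
Proof.
move=> [_ [[lv Wv]|[[na bv] [y [y' [ly Wy [_ by'] e yy']]]]]].
  by exists v; split=> // a'; clear; lia.
exists y; split=> //; last by rewrite na.
by apply: within_trans (within_sym yy'); apply: box_of_within (esym e).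
Qed.

(** Nearby points are attached to the same member. For fine colours both
    images are in members of an r-disjoint family; for coarse ones boxes
    intervene, and r' exceeds their size. *)
Lemma attached_inj a v v' W W' : attached a v W -> attached a v' W' ->
  within 2 v v' -> W = W'.
Proof.
move=> av av' vv'; have [[FW _] [FW' _]] := (av, av').
have [y [ly Wy vy yv]] := attached_near av.
have [y' [ly' Wy' vy' yv']] := attached_near av'.
have [na|na] := boolP (n < a)%N.
  apply: (r_disjoint_close (F_coarse na) FW FW' Wy Wy').
  apply: le_trans r'_ge; apply: mdist_grid_le.
  have := within_trans (within_trans (within_sym vy) vv') vy'.
  by move=> h b; have := h b; clear; lia.
apply: (r_disjoint_close (F_fine (a := a)) FW FW' Wy Wy').
by apply: le_trans r_ge; apply: mdist_grid_le; rewrite yv // yv'.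
Qed.

(** A box next to a piece of the same colour is attached to it; this is what
    keeps the pieces of one colour apart. *)
Lemma attached_boxed a v v' W : attached a v W -> boxed a v' -> within 2 v v' ->
  attached a v' W.
Proof.
move=> [FW [[lv Wv]|[[na bv] [y [y' [ly Wy by' e yy']]]]]] bv' vv'; split=> //; right.
  by split=> //; exists v, v'.
split=> //; exists y, y'; split=> //; rewrite e; apply: box_of_adj => //.
by case: bv'.
Qed.

Lemma colour_key_attached a v W : attached a v W ->
  exists2 W', attached a v W' & colour_key a v = inl W'.
Proof.
move=> avW; rewrite /colour_key; case: pselect => [ex|[]]; last by exists W.
by case: cid => W' aW' /=; exists W'.
Qed.

Lemma colour_key_boxed a v : ~ (exists W, attached a v W) ->
  colour_key a v = inr (box_of (a - n.+1) v).
Proof. by rewrite /colour_key; case: pselect. Qed.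

(** The colours cover the grid: a low point has the colour of its image, and
    any other point is in a box. *)
Lemma two_scale_contradiction : False.
Proof.
have [||v hv] := @lebesgue_grid I _ coloured colour_key.
- move=> a v v' cv cv' vv'.
  have {}vv' : within 2 v v' by [].
  wlog : v v' cv cv' vv' / exists W, attached a v W.
    move=> hw; have [ex|nex] := pselect (exists W, attached a v W); first exact: hw.
    have [ex'|nex'] := pselect (exists W, attached a v' W).
      by apply/esym; apply: hw => //; exact: within_sym.
    rewrite !colour_key_boxed //; congr inr.
    by case: cv cv' => // -[_ bv] [//|[_ bv']]; exact: box_of_adj.
  move=> [W avW].
  have [W' avW'] : exists W', attached a v' W'.
    by case: cv' => // bv'; exists W; exact: attached_boxed bv' vv'.
  have [W1 a1 ->] := colour_key_attached avW.
  have [W2 a2 ->] := colour_key_attached avW'.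
  by congr inl; exact: attached_inj a1 a2 vv'.
- move=> a; have [D FD] := uniformly_bounded_ex (F_bounded a).
  exists ((Num.trunc D + 3) * P + (P + 2) + (P + 2) + P)%N => v v' cv cv'.
  have [[W avW]|nex] := pselect (exists W, attached a v W).
    have [W1 a1 ->] := colour_key_attached avW.
    have [[W' avW']|nex'] := pselect (exists W, attached a v' W); last first.
      by rewrite (colour_key_boxed nex').
    have [W2 a2 ->] := colour_key_attached avW' => -[W12]; subst W2.
    have [y [ly Wy vy _]] := attached_near a1.
    have [y' [ly' Wy' vy' _]] := attached_near a2.
    have FW1 : F a W1 by case: a1.
    have := mdist_grid_ge a (FD _ _ _ FW1 Wy Wy').
    by have := vy a; have := vy' a; clear; lia.
  rewrite (colour_key_boxed nex).
  have [[W' avW']|nex'] := pselect (exists W, attached a v' W).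
    by have [W1 _ ->] := colour_key_attached avW'.
  rewrite (colour_key_boxed nex') => -[e].
  case: cv cv' => // -[_ bv] [//|[_ bv']].
  by have := box_of_within bv bv' e a; clear; lia.
have [lv|[t tm tv]] := low_or_avoids v.
  have [a [W FW Wv]] := F_cover (low_Y lv).
  by apply: (hv a); left; exists W; split=> //; left.
have ta : (n.+1 + t < d)%N by rewrite /d; move: tm; clear; lia.
apply: (hv (Ordinal ta)); right; split=> /=; last by rewrite addKn.
by rewrite addSn ltnS leq_addr.
Qed.

End Core.

(** * Ordinals *)

Section Ordinals.
Implicit Types a b c l : ordnum.

Lemma ole_refl a : ole a a.
Proof. by elim: a => T f IH i; exists i; exact: IH. Qed.

Lemma ole_trans a b c : ole a b -> ole b c -> ole a c.
Proof.
elim: a b c => T f IH [U g] [W h] ab bc i.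
by have [j fg] := ab i; have [k gh] := bc j; exists k; exact: IH fg gh.
Qed.

Lemma olt_ole_trans a b c : olt a b -> ole b c -> olt a c.
Proof.
case: b c => [U g] [W h] [j aj] bc; have [k jk] := bc j.
by exists k; exact: ole_trans aj jk.
Qed.

Lemma ole_olt_trans a b c : ole a b -> olt b c -> olt a c.
Proof. by case: c => [W h] ab [j bj]; exists j; exact: ole_trans ab bj. Qed.

Lemma oleP a b : (forall c, olt c a -> olt c b) -> ole a b.
Proof.
case: a b => [T f] [U g] h i; have [|j fj] := h (f i); last by exists j.
by exists i; exact: ole_refl.
Qed.

Lemma olt_osucc a b : olt a (osucc b) <-> ole a b.
Proof. by split=> [[]|ab] //; exists tt. Qed.

Lemma osucc_ole a b : ole (osucc a) b <-> olt a b.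
Proof. by case: b => U g; split=> [/(_ tt)|h []]. Qed.

Lemma ole0 a : ole ozero a. Proof. by case: a => U g []. Qed.

Lemma olt0 a : ~ olt a ozero. Proof. by case. Qed.

Lemma ole_addr c b : ole c (oadd c b).
Proof. by case: c b => [T f] [U g] i; exists (inl i); exact: ole_refl. Qed.

Lemma oadd0_le c : ole (oadd c ozero) c.
Proof. by case: c => T f [i|[]]; exists i; refine (ole_refl _). Qed.

Lemma ole_component (T : Type) (f : T -> ordnum) i : ole (f i) (osup f).
Proof.
have [a fia] : exists a, a = f i by exists (f i).
elim: a T f i fia => U g IH T f i fia; rewrite -fia => j.
by exists i; rewrite -fia; apply: (IH j U g j).
Qed.

Lemma olt_ole a b : olt a b -> ole a b.
Proof. by case: b => U g [j aj]; exact: ole_trans aj (ole_component _ _). Qed.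

Lemma olt_oaddl c b i : olt i c -> olt i (oadd c b).
Proof. by move=> ic; exact: olt_ole_trans ic (ole_addr _ _). Qed.

Lemma oaddS_le c b : ole (oadd c (osucc b)) (osucc (oadd c b)).
Proof.
apply/oleP => i ilt; apply/olt_osucc.
case: c ilt => [T f] [[j|[]]] //= ij.
by apply: olt_ole; apply: olt_oaddl; exists j.
Qed.

Lemma olt_oaddS c b : olt (oadd c b) (oadd c (osucc b)).
Proof. by case: c => [T f]; exists (inr tt); exact: ole_refl. Qed.

Lemma limit_le_osucc l c : olimit l -> ole l (osucc c) -> ole l c.
Proof.
move=> [_ limS] lc; apply/oleP => b bl.
by apply/osucc_ole; apply/olt_osucc; exact: olt_ole_trans (limS _ bl) lc.
Qed.

(** A limit ordinal below a successor is below its predecessor. For b at most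
    omega + n this bounds lambda(b) by omega, and for finite b it bounds
    lambda(b) by 0. *)
Lemma limit_le_addn l c n : olimit l -> ole l (oadd c (onat n)) -> ole l c.
Proof.
move=> liml; elim: n => [|n IH] h; first exact: ole_trans h (oadd0_le _).
by apply: IH; apply: (limit_le_osucc liml); exact: ole_trans h (oaddS_le _ _).
Qed.

Lemma onat_le_omega n : ole (onat n) omega.
Proof. exact: ole_component. Qed.

Definition omega2 := oadd omega omega.

Lemma olt_omega2P b : olt b omega2 <-> exists m, ole b (oadd omega (onat m)).
Proof.
split=> [[[j|j] /= bj]|[m bm]]; last by exists (inr m).
  exists 0%N; apply: ole_trans bj _.
  exact: ole_trans (onat_le_omega j) (ole_addr _ _).
by exists j.
Qed.

Lemma olimit_omega : olimit omega.
Proof.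
split=> [|b [n bn]]; first by exists 0%N; exact: ole_refl.
by exists n.+1; apply/osucc_ole/olt_osucc.
Qed.

Lemma olimit_omega2 : olimit omega2.
Proof.
split=> [|b /olt_omega2P[m bm]]; apply/olt_omega2P; first by exists 0%N; exact: ole0.
by exists m.+1; apply/osucc_ole; apply: ole_olt_trans bm _; exact: olt_oaddS.
Qed.

Lemma odecomp_omega2 : odecomp omega2 omega2 0.
Proof.
split; last by right; exact: olimit_omega2.
by split; [exact: ole_addr|exact: oadd0_le].
Qed.

Lemma odecomp_omega_addn n : odecomp (oadd omega (onat n)) omega n.
Proof. by split; [split; exact: ole_refl|right; exact: olimit_omega]. Qed.

Lemma oadd0l_le n : ole (oadd ozero (onat n)) (onat n).
Proof.
elim: n => [|n IH]; first exact: oadd0_le.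
apply: ole_trans (oaddS_le _ _) _; apply/osucc_ole; apply: ole_olt_trans IH _.
by apply/olt_osucc; exact: ole_refl.
Qed.

Lemma onat_le_add0 n : ole (onat n) (oadd ozero (onat n)).
Proof.
elim: n => [|n IH]; first exact: ole_addr.
by apply/osucc_ole; apply: ole_olt_trans IH _; exact: olt_oaddS.
Qed.

Lemma odecomp_onat n : odecomp (onat n) ozero n.
Proof.
split; last by left; split; exact: ole_refl.
by split; [exact: onat_le_add0|exact: oadd0l_le].
Qed.

End Ordinals.

(** * The ordinal of a family of finite sets *)

Section Ord.
Implicit Types (M T : set {fset posnat}) (a : ordnum).
Local Open Scope fset_scope.

Lemma Ord_le_inv M a : Ord_le M a ->
  M = set0 \/ forall n : posnat, Ord_lt (fin_trace M [fset n]) a.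
Proof. by case=> {M a} [a _|M a _ h]; [left|right]. Qed.

Lemma Ord_lt_inv M a : Ord_lt M a -> exists2 b, olt b a & Ord_le M b.
Proof. by case=> {M a} M a b ba Mb; exists b. Qed.

Lemma ole0_or_gt0 a : ole a ozero \/ olt ozero a.
Proof.
case: a => T f; have [[i _]|n] := pselect (exists i : T, True).
  by right; exists i; exact: ole0.
by left=> i; case: n; exists i.
Qed.

Lemma fin_trace_set0 s : fin_trace set0 s = set0.
Proof. by apply/seteqP; split=> t // [_ []]. Qed.

Lemma Ord_le_set0 a : Ord_le set0 a.
Proof.
have z : Ord_le set0 ozero by apply: Ord_le_zero; split; exact: ole_refl.
have [a0|a0] := ole0_or_gt0 a; first by apply: Ord_le_zero; split=> //; exact: ole0.
by apply: Ord_le_pos => // n; rewrite fin_trace_set0; exact: Ord_lt_le a0 z.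
Qed.

Lemma Ord_le_mono M a b : Ord_le M a -> ole a b -> Ord_le M b.
Proof.
case=> {M a} [a _|M a a0 h] ab; first exact: Ord_le_set0.
apply: Ord_le_pos => [|n]; first exact: olt_ole_trans a0 ab.
have [c ca Mc] := Ord_lt_inv (h n).
by apply: Ord_lt_le Mc; exact: olt_ole_trans ca ab.
Qed.

Lemma Ord_le_finite M j :
  (forall t, M t -> t <> fset0 /\ (#|` t| <= j)%N) -> Ord_le M (onat j).
Proof.
elim: j M => [|j IH] M hM.
  rewrite (_ : M = set0); first exact: Ord_le_set0.
  apply/seteqP; split=> t // /hM[t0]; rewrite leqn0 cardfs_eq0 => /eqP; exact: t0.
apply: Ord_le_pos => [|n]; first by apply/olt_osucc; exact: ole0.
apply: (@Ord_lt_le _ _ (onat j)); first by apply/olt_osucc; exact: ole_refl.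
apply: IH => t [t0 [/hM[_ tn] dis]]; split=> //.
rewrite fsetUC cardfsU1 (_ : n \notin t) in tn; first by [].
by apply/negP => nt; have := in_fset0 n; rewrite -dis !inE nt eqxx.
Qed.

Lemma Ord_le_finite_inv M j t : Ord_le M (onat j) -> M t -> (#|` t| <= j)%N.
Proof.
elim: j M t => [|j IH] M t /Ord_le_inv[->//|h] Mt.
  by have [b /olt0] := Ord_lt_inv (h (posn 0)).
have [->|/fset0Pn[n nt]] := eqVneq t fset0; first by rewrite cardfs0.
have [b /olt_osucc bj hb] := Ord_lt_inv (h n).
rewrite (cardfsD1 n) nt add1n ltnS.
have [->|/eqP t0] := eqVneq (t `\ n) fset0; first by rewrite cardfs0.
apply: (IH _ _ (Ord_le_mono hb bj)); split=> //; split.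
  by rewrite fsetUC fsetD1K.
by apply/fsetP => x; rewrite !inE; case: (x == n); rewrite ?andbF.
Qed.

Lemma fin_trace_sub1 T M (s : {fset posnat}) n : (M `<=` fin_trace T s)%classic ->
  (fin_trace M [fset n]%fset `<=` fin_trace T (n |` s)%fset)%classic.
Proof.
move=> MT t [t0 [/MT[_ [Tt dis]] dis']]; split=> //; split; first by rewrite fsetUA.
apply/fsetP => x; have /fsetP/(_ x) := dis; have /fsetP/(_ x) := dis'.
by rewrite !inE; case: (x \in t); case: (x == n).
Qed.

(** Peeling off m + 1 elements, one for each step of the induction on the
    ordinal, has to lead from s to a set with at least N elements. An element
    already in s leaves the empty trace. *)
Lemma Ord_le_omega_add T (n0 : posnat) N :
  (forall s : {fset posnat}, n0 \in s -> (N <= #|` s|)%N ->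
     exists j, forall t, fin_trace T s t -> (#|` t| <= j)%N) ->
  forall m s M, n0 \in s -> (M `<=` fin_trace T s)%classic -> (N <= #|` s| + m.+1)%N ->
  Ord_le M (oadd omega (onat m)).
Proof.
move=> bounded; elim=> [|m IH] s M as0 Ms sN; apply: Ord_le_pos => [|n].
- apply: (@olt_ole_trans _ omega); last exact: ole_addr.
  by exists 0%N; exact: ole_refl.
- have [ns|ns] := boolP (n \in s).
    rewrite (_ : fin_trace M _ = set0).
      apply: (Ord_lt_le _ (Ord_le_set0 ozero)); apply: olt_oaddl.
      by exists 0%N; exact: ole_refl.
    apply/seteqP; split=> t // [_ [/Ms[_ [_ /fsetP/(_ n)]]]].
    by rewrite !inE ns eqxx orbT.
  have [||j hj] := bounded (n |` s).
  + by rewrite !inE as0 orbT.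
  + by rewrite cardfsU1 ns; move: sN; clear; lia.
  apply: (@Ord_lt_le _ _ (onat j)).
    by apply: olt_oaddl; exists j; exact: ole_refl.
  apply: Ord_le_finite => t /(fin_trace_sub1 Ms) /[dup] [[t0 _]] /hj; by split.
- apply: olt_oaddl; by exists 0%N; exact: ole_refl.
- apply: (@Ord_lt_le _ _ (oadd omega (onat m))); first exact: olt_oaddS.
  have [ns|ns] := boolP (n \in s).
    rewrite (_ : fin_trace M _ = set0); first exact: Ord_le_set0.
    apply/seteqP; split=> t // [_ [/Ms[_ [_ /fsetP/(_ n)]]]].
    by rewrite !inE ns eqxx orbT.
  apply: (IH (n |` s)); [by rewrite !inE as0 orbT|exact: fin_trace_sub1|].
  by rewrite cardfsU1 ns; move: sN; clear; lia.
Qed.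

(** Conversely, an ordinal at most omega + m forces the traces on all sets of
    m + 1 elements to be bounded. *)
Lemma Ord_le_omega_add_inv m M (s : {fset posnat}) :
  Ord_le M (oadd omega (onat m)) -> #|` s| = m.+1 ->
  exists j, forall t, fin_trace M s t -> (#|` t| <= j)%N.
Proof.
elim: m M s => [|m IH] M s /Ord_le_inv[->|h] sm;
  try by exists 0%N => t; rewrite fin_trace_set0.
  have /fset0Pn[n ns] : s != fset0 by rewrite -cardfs_eq0 sm.
  have sE : s = [fset n].
    apply/eqP; rewrite eq_sym eqEfcard fsub1set ns cardfs1 sm //.
  have [b bo hb] := Ord_lt_inv (h n).
  have [j bj] := olt_ole_trans bo (oadd0_le omega).
  exists j => t; rewrite sE; exact: Ord_le_finite_inv (Ord_le_mono hb bj).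
have /fset0Pn[n ns] : s != fset0 by rewrite -cardfs_eq0 sm.
have sn : #|` s `\ n| = m.+1.
  by move: sm; rewrite (cardfsD1 n) ns add1n => -[].
have [b bo hb] := Ord_lt_inv (h n).
have bm : ole b (oadd omega (onat m)).
  by apply/olt_osucc; exact: olt_ole_trans bo (oaddS_le _ _).
have [j hj] := IH _ _ (Ord_le_mono hb bm) sn.
exists j => t [t0 [Mt dis]]; apply: hj.
have /fsetP dis' := dis.
split=> //; split; last first.
  by apply/fsetP => x; have := dis' x; rewrite !inE; case: (x \in t); case: (x == n).
split; last split.
- move=> e; have /fsetP/(_ n) := e.
  have [y yt] : exists y, y \in t by apply/fset0Pn/eqP.
  by have /fsetP/(_ y) := e; rewrite !inE yt.
- by rewrite -fsetUA [_ `|` [fset n]]fsetUC fsetD1K.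
- apply/fsetP => x; have := dis' x; rewrite !inE.
  by case: (eqVneq x n) => [->|_]; rewrite ?ns /= ?andbF ?andbT ?orbF //.
Qed.

End Ord.

(** * The impossibility of covering at two scales *)

Section Main.
Variable R : realType.
Notation X := (as_copies (as_copies (direct_sum R))).
Notation Y := (Y_2omega R).
Implicit Types (B : set X) (U W : nat -> set (set X)).

Definition bounded_families n r U : Prop :=
  forall c, (c <= n)%N -> uniformly_bounded (U c) /\ r_disjoint r (U c).

Definition covered n U (p : X) : Prop :=
  exists2 c, (c <= n)%N & family_union (U c) p.

Definition split_cover n r m r' : Prop := exists U W,
  [/\ bounded_families n r U, bounded_families m r' W &
      forall p, Y p -> covered n U p \/ covered m W p].

(** The scale r = 2^(n + 2) is twice the step of the grid; r' is chosen after
    m, so it may exceed the size of the boxes, which depends on m. *)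
Lemma no_split_cover n : ~ forall r, 0 < r -> exists m,
  forall r', 0 < r' -> split_cover n r m r'.
Proof.
move=> h; set r : R := (2 ^ n.+1 * 2)%:R.
have r0 : 0 < r by rewrite ltr0n muln_gt0 expn_gt0.
have [m hm] := h r r0; set q : R := (2 ^ n.+1 * (2 * (2 ^ m.+1 + m.+1 * 3) + 6))%:R.
have q0 : 0 <= q by exact: ler0n.
have [|U [W [Ur Wr cov]]] := hm (r + q); first by lra.
pose F (a : 'I_(n + m + 1).+1) := if (a <= n)%N then U a else W (a - n.+1)%N.
have aW (a : 'I_(n + m + 1).+1) : (a - n.+1 <= m)%N.
  by have := ltn_ord a; clear; lia.
apply: (@two_scale_contradiction R n m F r (r + q)) => //.
- move=> a; rewrite /F; case: leqP => an; first by have [] := Ur _ an.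
  by have [_ /r_disjoint_le] := Wr _ (aW a); apply; lra.
- by move=> a an; rewrite /F leqNgt an /=; have [] := Wr _ (aW a).
- by move=> a; rewrite /F; case: leqP => an; [have [] := Ur _ an|have [] := Wr _ (aW a)].
- move=> p /cov[[c cn Up]|[c cm Wp]].
    have cd : (c < (n + m + 1).+1)%N by move: cn; clear; lia.
    by exists (Ordinal cd); rewrite /F /= cn.
  have cd : (n.+1 + c < (n + m + 1).+1)%N by move: cm; clear; lia.
  exists (Ordinal cd); rewrite /F /= ifF; first by rewrite addKn.
  by rewrite leqNgt addSn ltnS leq_addr.
- by rewrite -/q; lra.
Qed.

(** * The complementary-finite dimension *)

Section Coasdim.

Lemma coasdim_le_inv B c : coasdim_le B c -> exists l n, odecomp c l n /\
  forall r, 0 < r -> exists U, bounded_families n r U /\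
    exists2 B', coasdim_lt B' l & forall p, B p -> covered n U p \/ B' p.
Proof.
case=> {B c} B c l n cln h; exists l, n; split=> // r /h[F [FP lt]].
exists (fun c => F (inord c)); split=> [t tn|]; first by have [] := FP (inord t).
exists (B `\` \bigcup_i family_union (F i)) => // p Bp.
have [[t _ Fp]|np] := pselect ((\bigcup_i family_union (F i)) p); last by right.
by left; exists t; [exact: (ltn_ord t)|rewrite inord_val].
Qed.

Lemma coasdim_lt_inv B c : coasdim_lt B c ->
  B = set0 \/ exists2 b, olt b c & coasdim_le B b.
Proof. by case=> {B c} [c|B c b bc Bb]; [left|right; exists b]. Qed.

(** A dimension below omega is finite, so that the number of families does not
    depend on the scale. *)
Lemma coasdim_lt_omega B l : ole l omega -> coasdim_lt B l ->
  exists n, forall r, 0 < r -> exists U,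
    bounded_families n r U /\ forall p, B p -> covered n U p.
Proof.
move=> lo /coasdim_lt_inv[->|[b bl]].
  exists 0%N => r _; exists (fun=> set0); split=> // c _; split=> //.
  by rewrite /uniformly_bounded image_set0 ereal_sup0.
have [j bj] := olt_ole_trans bl lo.
move=> /coasdim_le_inv[l' [n [[[_ l'n] l'lim] h]]]; exists n => r /h[U [Ur [B' B'l' cov]]].
exists U; split=> // p /cov[//|B'p].
have l'0 : ole l' ozero.
  case: l'lim => [[]//|lim]; apply: (@limit_le_addn _ _ j lim).
  apply: ole_trans (ole_trans (ole_addr _ _) (ole_trans l'n bj)) _.
  exact: onat_le_add0.
case: (coasdim_lt_inv B'l') => [B'0|[b' b'l' _]]; first by rewrite B'0 in B'p.
by case: (olt0 (olt_ole_trans b'l' l'0)).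
Qed.

Lemma Y_coasdim_ge : ~ coasdim_lt Y omega2.
Proof.
(* Empty families would cover an empty space at any two scales. *)
move=> /coasdim_lt_inv[Y0|[b /olt_omega2P[j bj] /coasdim_le_inv]].
  apply: (@no_split_cover 0%N) => r r0; exists 0%N => r' r'0.
  exists (fun=> set0), (fun=> set0); split=> [c _|c _|p]; last by rewrite Y0.
    by split=> //; rewrite /uniformly_bounded image_set0 ereal_sup0.
  by split=> //; rewrite /uniformly_bounded image_set0 ereal_sup0.
move=> [l [n [[[_ ln] llim] h]]]; have lo : ole l omega.
  case: llim => [[l0 _]|lim]; first exact: ole_trans l0 (ole0 _).
  by apply: (limit_le_addn lim); exact: ole_trans (ole_addr _ _) (ole_trans ln bj).
apply: (@no_split_cover n) => r /h[U [Ur [B Bl cov]]].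
have [m hm] := coasdim_lt_omega lo Bl; exists m => r' /hm[W [Wr' covW]].
by exists U, W; split=> // p /cov[|/covW]; [left|right].
Qed.

Lemma coasdim_le_finite B k0 i0 : B `<=` Y -> (forall p, B p -> (p.1 < k0)%N) ->
  (forall p, B p -> (p.2.1 < i0)%N) -> coasdim_le B (onat i0).
Proof.
move=> BY Bk Bi; apply: (CoasdimLe (odecomp_onat i0)) => r r0.
have [F [FP cov]] := cover_finite r0 BY Bk Bi; exists F; split=> //.
rewrite (_ : _ `\` _ = set0); first exact: CoasdimLtEmpty.
by apply/seteqP; split=> p // [/cov].
Qed.

Lemma coasdim_le_skeleta k0 :
  coasdim_le [set p | Y p /\ (p.1 < k0)%N] (oadd omega (onat k0)).
Proof.
apply: (CoasdimLe (odecomp_omega_addn k0)) => r r0.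
have [i0 [F [FP cov]]] := cover_skeleta k0 r0; exists F; split=> //.
apply: (@CoasdimLtLe _ _ _ _ (onat i0)); first by exists i0; exact: ole_refl.
apply: (@coasdim_le_finite _ k0 i0) => [p [[]]//|p [[]]//|p [[Yp pk] np]].
by rewrite ltnNge; apply/negP => pi; apply: np; exact: cov.
Qed.

Lemma Y_coasdim_le : coasdim_le Y omega2.
Proof.
apply: (CoasdimLe odecomp_omega2) => r r0.
have [k0 [F [F1 F2 F3 FU]]] := cover_large r0; exists (fun=> F); split=> //.
apply: (@CoasdimLtLe _ _ _ _ (oadd omega (onat k0))).
  by apply/olt_omega2P; exists k0; exact: ole_refl.
rewrite (_ : _ `\` _ = [set p | Y p /\ (p.1 < k0)%N]); first exact: coasdim_le_skeleta.
apply/seteqP; split=> p /= [Yp np]; split=> //.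
  by rewrite ltnNge; apply/negP => pk; apply: np; exists ord0; rewrite ?FU.
by move=> [c _]; rewrite FU /= => -[_]; rewrite leqNgt np.
Qed.

End Coasdim.

(** * The transfinite asymptotic dimension *)

Section Trasdim.
Local Open Scope fset_scope.

Lemma fset_bounded (s : {fset posnat}) :
  exists2 r : R, 0 < r & forall b, b \in s -> b%:R <= r.
Proof.
exists (\sum_(b <- s) (nat_of_posnat b)%:R + 1)%R => [|b bs].
  by rewrite ltr_wpDl // sumr_ge0.
by rewrite (big_rem b) //= -addrA lerDl addr_ge0 // sumr_ge0.
Qed.

(** The given element pays for the points with k >= k0, k0 + 1 other elements of
    s pay for k < k0 and i >= i0, and i0 + 1 elements of t pay for the rest. As
    i0 depends only on s, larger sets t cannot be in the trace on s. *)
Lemma trasdim_bounded (n0 : posnat) : exists N, forall s : {fset posnat},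
  n0 \in s -> (N <= #|` s|)%N ->
  exists j, forall t, fin_trace (trasdim_family Y) s t -> (#|` t| <= j)%N.
Proof.
have n0r : (0 : R) < n0%:R by rewrite ltr0n; exact: (valP n0).
have [k0 [F0 [F01 F02 F03 F0U]]] := cover_large n0r.
exists k0.+2 => s n0s sN; have [r r0 sr] := fset_bounded s.
have [i0 [F1 [F1P cov1]]] := cover_skeleta k0 r0.
exists i0 => t [t0 [Tts /fsetP ts]]; rewrite leqNgt; apply/negP => ti.
have [r2 r20 tr2] := fset_bounded t.
pose B := [set p : X | [/\ Y p, (p.1 < k0)%N & (p.2.1 < i0)%N]].
have [F2 [F2P cov2]] : exists F : 'I_i0.+1 -> set (set X),
    (forall c, [/\ family_of_subsets B (F c), uniformly_bounded (F c)
                & r_disjoint r2 (F c)]) /\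
    (B `<=` \bigcup_c family_union (F c))%classic.
  by apply: (@cover_finite _ B k0) => // p [].
pose s1 : seq posnat := enum_fset (s `\ n0).
pose t1 : seq posnat := enum_fset t.
have s1k : (k0 < size s1)%N.
  by move: sN; rewrite (cardfsD1 n0) n0s.
case: Tts => _; apply.
exists (fun b => if b == n0 then F0 else if b \in s then F1 (inord (index b s1))
  else F2 (inord (index b t1))); split.
  move=> b; rewrite inE => bts.
  case: eqP => [->//|bn0]; case: ifP => bs.
    have [Fsub Fb Fd] := F1P (inord (index b s1)).
    split=> //; last by apply: r_disjoint_le Fd; exact: sr.
    by move=> U FU p Up; have [] := Fsub U FU p Up.
  have [Fsub Fb Fd] := F2P (inord (index b t1)).
  split=> //; last by apply: r_disjoint_le Fd; apply: tr2; rewrite bs orbF in bts.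
  by move=> U FU p Up; have [] := Fsub U FU p Up.
move=> p Yp; have [pk|pk] := leqP k0 p.1.
  exists n0; first by rewrite /= inE n0s orbT.
  by rewrite eqxx F0U.
have [pi|pi] := leqP i0 p.2.1.
  have [c _ Fc] := cov1 p Yp pk pi.
  pose b := nth n0 s1 c.
  have cs : (c < size s1)%N by apply: leq_trans (ltn_ord c) _.
  have : b \in s `\ n0 by exact: mem_nth.
  rewrite in_fsetD1 => /andP[/negPf bn0 bs].
  exists b; first by rewrite /= inE bs orbT.
  by rewrite bn0 bs index_uniq ?fset_uniq // inord_val.
have [|c _ Fc] := cov2 p; first by split.
pose b := nth n0 t1 c.
have ct : (c < size t1)%N by apply: leq_trans (ltn_ord c) _.
have bt : b \in t by exact: mem_nth.
have bs : (b \in s) = false by have := ts b; rewrite !inE bt.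
have bn0 : (b == n0) = false by apply: contraFF bs => /eqP->.
exists b; first by rewrite /= inE bt.
by rewrite bn0 bs index_uniq ?fset_uniq // inord_val.
Qed.

Lemma Y_trasdim_le : Ord_le (trasdim_family Y) omega2.
Proof.
apply: Ord_le_pos => [|n0].
  by apply/olt_omega2P; exists 0%N; exact: ole0.
have [N bounded] := trasdim_bounded n0.
apply: (@Ord_lt_le _ _ (oadd omega (onat N))).
  by apply/olt_omega2P; exists N; exact: ole_refl.
apply: (Ord_le_omega_add bounded (s := [fset n0])) => //; first by rewrite inE.
by rewrite cardfs1; clear; lia.
Qed.

Definition block (K n : nat) : {fset posnat} := [fset posn (K + val c)%N | c in 'I_n].

Lemma card_block K n : #|` block K n| = n.
Proof.
rewrite card_imfset /=; first by rewrite size_enum_ord.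
by move=> c c' [/addnI/val_inj].
Qed.

Lemma in_block K n b : b \in block K n ->
  exists2 c, (c < n)%N & b = posn (K + c)%N.
Proof. by move=> /imfsetP[c _ ->]; exists c; [exact: (ltn_ord c)|]. Qed.

(** A block of m + 1 elements above r is fixed first; this determines j, and
    then a block of j + 1 elements above r' can be taken for any r'. *)
Lemma Y_trasdim_ge : ~ Ord_lt (trasdim_family Y) omega2.
Proof.
move=> /Ord_lt_inv[b /olt_omega2P[m bm] /Ord_le_mono/(_ bm) Tm].
apply: (@no_split_cover m) => r r0; set K := (Num.trunc r).+1.
have rK c : (r <= (K + c).+1%:R)%R.
  have := truncnS_gt r; rewrite -/K -addn1 !natrD => h.
  by have := ler0n R c; lra.
have [j hj] := Ord_le_omega_add_inv Tm (card_block K m.+1).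
exists j => r' r'0; set K' := (K + m.+1 + (Num.trunc r').+1)%N.
have rK' c : (r' <= (K' + c).+1%:R)%R.
  have := truncnS_gt r'; rewrite /K' -addn1 !natrD => h.
  by have := ler0n R c; have := ler0n R K; have := ler0n R m.+1; lra.
pose t := block K' j.+1.
have t0 : t <> fset0.
  by move=> e; have := card_block K' j.+1; rewrite -/t e cardfs0.
have dis : t `&` block K m.+1 = fset0.
  apply/fsetP => x; rewrite !inE; apply/negP => /andP[/in_block[c _ xc] /in_block[c' c'm]].
  by rewrite xc => -[]; move: c'm; rewrite /K'; clear; lia.
have nT : ~ trasdim_family Y (t `|` block K m.+1).
  by move=> Tt; have := hj t (conj t0 (conj Tt dis)); rewrite card_block ltnn.
have ts0 : t `|` block K m.+1 <> fset0.
  by move=> /eqP; rewrite fsetU_eq0 => /andP[/eqP].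
have [F [FP cov]] := contrapT (fun nF => nT (conj ts0 nF)).
exists (fun c => F (posn (K + c)%N)), (fun c => F (posn (K' + c)%N)); split.
- move=> c cm; have [|_ Fb Fd] := FP (posn (K + c)%N).
    by rewrite inE; apply/orP; right; apply/imfsetP; exists (Ordinal (cm : (c < m.+1)%N)).
  by split=> //; apply: r_disjoint_le Fd; exact: rK.
- move=> c cj; have [|_ Fb Fd] := FP (posn (K' + c)%N).
    by rewrite inE; apply/orP; left; apply/imfsetP; exists (Ordinal (cj : (c < j.+1)%N)).
  by split=> //; apply: r_disjoint_le Fd; exact: rK'.
- move=> p /cov[i /=]; rewrite inE => /orP[/in_block[c cj ->]|/in_block[c cm ->]] Fp.
    by right; exists c.
  by left; exists c.
Qed.

End Trasdim.

End Main.

Theorem proposition4p1 (R : realType) :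
  coasdim_eq (Y_2omega R) (oadd omega omega) /\
  trasdim_eq (Y_2omega R) (oadd omega omega).
Proof.
split; split; [exact: Y_coasdim_le|exact: Y_coasdim_ge|
  exact: Y_trasdim_le|exact: Y_trasdim_ge].
Qed.
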